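(* Let $\{X_k(m): m\in\mathbb{R}_+,\ k\in\mathbb{N}\}$ be a family of integrable real random variables that are independent in $k$. Assume: (C) $\mathbb{E}[X_k(m)]=0$ for all $m,k$; (S1) there is $\delta>0$ such that for every $\varepsilon>0$ there is $C=C(\varepsilon)$ with $\sup_k\mathbb{P}(|X_k(m)|>\varepsilon)<C/m^{\delta}$ for all $m$; (S2) there are a random variable $X_*$ and $\gamma>0$ with $\mathbb{E}[|X_*|^{2+\gamma}]<\infty$ and $\sup_{k,m}\mathbb{P}(X_k(m)>x)\le\mathbb{P}(X_*>x)$ for all $x\in\mathbb{R}$; (S3) for every $\varepsilon>0$ there are $\beta>1$ and $C_\varepsilon>0$ such that for all $t,r,m>0$, $\sup_k\mathbb{P}\big(\sup_{s\le m}|(r+s)X_k(r+s)-rX_k(r)|\ge t\varepsilon\big)\le C_\varepsilon m^\beta/t^\beta$. Let $(m_k)_{k\in\mathbb N}$ be any sequence of positive reals with $\sum_k m_k=\infty$, let $M_0=0$, $M_n=\sum_{k=1}^n m_k$, and for $t>0$ let $\ell_t=\inf\{\ell\in\mathbb N: M_\ell\ge t\}$, $\bar t=t-M_{\ell_t-1}$, and $\mathcal S_t=\sum_{k=1}^{\ell_t-1}\frac{m_k}{t}X_k(m_k)+\frac{\bar t}{t}X_{\ell_t}(\bar t)$. Then $\mathbb{P}(\lim_{t\to\infty}\mathcal S_t=0)=1$.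
   Context: $\mathbb{R}_+$ denotes the positive reals. ''Independent in $k$'' means that the families $\{X_k(m): m\in\mathbb{R}_+\}$ for different $k$ are independent. *)

(* Defs.v *)
From HB Require Import structures.
From mathcomp Require Import all_boot all_order all_algebra.
From mathcomp Require Import all_classical all_reals all_analysis.
Set Implicit Arguments. Unset Strict Implicit. Unset Printing Implicit Defensive.
Import Order.TTheory GRing.Theory Num.Theory.
Local Open Scope classical_set_scope.
Local Open Scope ring_scope.

Section defs.
Context {d : measure_display} {T : measurableType d} {R : realType}.

Definition gen_family (X : nat -> R -> T -> R) (k : nat) : set (set T) :=
  <<s [set A | exists m (B : set R), 0 < m /\ measurable B /\ A = X k m @^-1` B] >>.

Definition indep_in_k (P : probability T R) (X : nat -> R -> T -> R) : Prop :=
  forall (J : seq nat) (A : nat -> set T), uniq J -> all (fun k => (0 < k)%N) J ->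
    (forall k, k \in J -> gen_family X k (A k)) ->
    P (\bigcap_(k in [set` J]) A k) = (\prod_(k <- J) P (A k))%E.

Definition Msum (mk : nat -> R) (n : nat) : R := \sum_(1 <= k < n.+1) mk k.

Definition ell (mk : nat -> R) (t : R) : nat :=
  xget 0%N [set l | t <= Msum mk l /\ forall j, t <= Msum mk j -> (l <= j)%N].

Definition tbar (mk : nat -> R) (t : R) : R := t - Msum mk (ell mk t).-1.

Definition St (X : nat -> R -> T -> R) (mk : nat -> R) (t : R) (w : T) : R :=
  \sum_(1 <= k < ell mk t) (mk k / t) * X k (mk k) w
  + (tbar mk t / t) * X (ell mk t) (tbar mk t) w.

End defs.

(* Main.v *)
(* Fix an exponent q in (1, 2] below the exponent of (S3). Letting
   r tend to 0 in (S3), where (S2) and centering make r X_k(r) negligible, gives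
   a tail of X_k(m) of order greater than q, hence a bound on E|X_k(m)|^q uniform
   in k and m. For weights mu_k of total mass at most t, the sum of the
   mu_k X_k(mu_k) exceeds eps t with probability O(t^-c): the terms with
   mu_k > t^(1-eta) are handled by (S1) and a union bound, the others by
   truncation at height t and Chebyshev's inequality, for which pairwise
   independence is enough. Finally run along the grid t_i = (i+1)^p. If p c >= q,
   the grid times contribute summable probabilities; between t_i and t_(i+1) the
   oscillation is controlled by (S3) and by q-th moments with probability
   O(((t_(i+1) - t_i) / t_i)^q) = O(i^-q), which is again summable because q > 1.
   No maximal inequality is needed, and Borel-Cantelli concludes. *)
Require Import Defs.
From HB Require Import structures.
From mathcomp Require Import all_boot all_order all_algebra.
From mathcomp Require Import all_classical all_reals all_analysis.
From mathcomp Require Import measurable_realfun ring lra.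
Import Order.TTheory GRing.Theory Num.Theory.
Local Open Scope classical_set_scope.
Local Open Scope ring_scope.
Set Implicit Arguments. Unset Strict Implicit. Unset Printing Implicit Defensive.

(** * Events failing with small probability *)

(** Two obstacles shape the argument. (S2) dominates upper tails only: it bounds moments of positive
    parts, and centering turns this into a bound on E|X_k(m)|, but not on E|X_k(m)|^q. That first
    moment is just enough to discard r X_k(r) as r tends to 0; (S3), which is two-sided, then
    supplies the q-th moment. Moreover, nothing bounds the number of masses below t or inside a
    window, so union bounds must be paid by mass and not by counting. Oscillation estimates are
    therefore kept in the homogeneous form C (m/u)^q with q > 1: for masses of total at most h, the
    sum of (m_k/u)^q is at most (h/u)^q. Likewise each term of a weighted sum is charged a multiple
    of mu_k/t, and these ratios sum to at most 1. The constraints on q have separate origins: q > 1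
    gives summability along the grid, q <= 2 lets q-th powers dominate truncated squares, and q <
    beta turns a tail of order beta into a q-th moment. *)

Section tail_events.
Context {d : measure_display} {T : measurableType d} {R : realType}.
Context (P : probability T R).

(* [G] itself need not be measurable: it may involve a supremum over an
   uncountable set of masses. *)
Definition fails_le (r : R) (G : T -> Prop) :=
  exists F : set T, [/\ measurable F, (P F <= r%:E)%E & forall w, ~ F w -> G w].

Lemma fails_le_mono (r s : R) (G H : T -> Prop) :
  r <= s -> (forall w, G w -> H w) -> fails_le r G -> fails_le s H.
Proof.
move=> rs GH [F [mF PF FG]]; exists F; split => //.
  by rewrite (le_trans PF)// lee_fin.
by move=> w /FG/GH.
Qed.

Lemma fails_le_and (r s : R) (G H : T -> Prop) :
  fails_le r G -> fails_le s H -> fails_le (r + s) (fun w => G w /\ H w).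
Proof.
move=> [F [mF PF FG]] [F' [mF' PF' FH]]; exists (F `|` F'); split.
- exact: measurableU.
- by rewrite (le_trans (measureU2 _ _ _))// EFinD leeD.
- by move=> w /not_orP[/FG ? /FH].
Qed.

Lemma fails_le_seq (I : eqType) (J : seq I) (r : I -> R) (G : I -> T -> Prop) :
  (forall k, k \in J -> fails_le (r k) (G k)) ->
  fails_le (\sum_(k <- J) r k) (fun w => forall k, k \in J -> G k w).
Proof.
elim: J => [_|k J IH H].
  by exists set0; split => //; rewrite measure0 big_nil.
rewrite big_cons.
have := fails_le_and (H k (mem_head _ _))
  (IH (fun j jJ => H j (@mem_behead _ (k :: J) _ jJ))).
apply: fails_le_mono => // w [Gk GJ] j.
by rewrite inE => /predU1P[->//|/GJ].
Qed.

Lemma nneseries_le_bound (u : nat -> \bar R) (v : nat -> R) (S : R) :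
  (forall n, 0 <= u n)%E -> (forall n, (u n <= (v n)%:E)%E) ->
  (forall n, \sum_(0 <= i < n) v i <= S) -> (\sum_(n <oo) u n <= S%:E)%E.
Proof.
move=> u0 uv vS; apply: lime_le; first exact: is_cvg_nneseries.
apply: nearW => n; apply: (@le_trans _ _ (\sum_(0 <= i < n) (v i)%:E)%E).
  exact: lee_sum.
by rewrite sumEFin lee_fin.
Qed.

Lemma fails_le_countable (r : nat -> R) (S : R) (G : nat -> T -> Prop) :
  (forall n, fails_le (r n) (G n)) ->
  (forall n, \sum_(0 <= i < n) r i <= S) ->
  fails_le S (fun w => forall n, G n w).
Proof.
move=> /choice[F HF] rS; exists (\bigcup_n F n); split.
- by apply: bigcupT_measurable => n; have [] := HF n.
- apply: (@le_trans _ _ (\sum_(n <oo) P (F n))%E).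
    apply: generalized_Boole_inequality; last apply: bigcupT_measurable.
      by move=> n; have [] := HF n.
    by move=> n; have [] := HF n.
  by apply: nneseries_le_bound rS => // n; have [] := HF n.
- move=> w nFw n; have [_ _] := HF n; apply; apply: contra_not nFw.
  by move=> Fw; exists n.
Qed.

Lemma fails_le_borel_cantelli (r : nat -> R) (S : R) (G : nat -> T -> Prop) :
  (forall n, fails_le (r n) (G n)) ->
  (forall n, \sum_(0 <= i < n) r i <= S) ->
  {ae P, forall w, \forall n \near \oo, G n w}.
Proof.
move=> /choice[F HF] rS; have mF n : measurable (F n) by have [] := HF n.
exists (lim_sup_set F); split.
- apply: bigcap_measurable => // k _.
  by apply: bigcup_measurable => j /= _; exact: mF.
- apply: lim_sup_set_cvg0 => //.
  apply: (@le_lt_trans _ _ S%:E); last exact: ltry.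
  by apply: nneseries_le_bound rS => // n; have [] := HF n.
- move=> w /= nGw n _; apply: contrapT => nF; apply: nGw.
  exists n => // k /= nk; have [_ _] := HF k; apply.
  by apply: contra_not nF => Fk; exists k.
Qed.

(** Disposes of the parameters for which a claimed failure probability reaches 1, so that the
    opposite inequality may be assumed. *)
Lemma fails_le_probability_le1 (r : R) (G : T -> Prop) :
  1 <= r -> fails_le r G.
Proof.
move=> r1; exists setT; split => //.
  by rewrite probability_setT lee_fin.
by move=> w; case.
Qed.

Lemma measurable_superlevel (f : T -> R) (a : R) :
  measurable_fun setT f -> measurable [set w | a <= f w].
Proof.
move=> mf; rewrite (_ : [set w | a <= f w] = f @^-1` `[a, +oo[); last first.
  by apply/seteqP; split => w /=; rewrite in_itv/= andbT.
by rewrite -[X in measurable X]setTI; exact: mf.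
Qed.

(** Integrate a 1_A <= f, where A is the set on which f >= a. Writing the integral bound as [a * r]
    avoids a division in the extended reals. *)
Lemma fails_le_markov (f : T -> R) (a r : R) : measurable_fun setT f ->
  (forall w, 0 <= f w) -> 0 < a -> (\int[P]_w (f w)%:E <= (a * r)%:E)%E ->
  fails_le r (fun w => f w < a).
Proof.
move=> mf f0 a0 fr; have mA := measurable_superlevel a mf.
exists [set w | a <= f w]; split => //; last first.
  by move=> w /= /negP; rewrite -ltNge.
rewrite -(@lee_pmul2l _ a%:E)// ?lte_fin// -EFinM.
apply: le_trans fr.
rewrite -[X in P X]setIT -(integral_indic P measurableT mA).
rewrite -ge0_integralZl_EFin//; last 2 first.
- by apply/measurable_EFinP; exact: measurable_indic.
- exact: ltW.
apply: ge0_le_integral => //.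
- by move=> w _; rewrite mule_ge0// lee_fin ltW.
- apply: measurable_funeM; apply/measurable_EFinP; exact: measurable_indic.
- exact/measurable_EFinP.
- move=> w _; rewrite -EFinM lee_fin indicE.
  by case: (boolP (w \in _)) => [/set_mem/= |_]; rewrite ?mulr1// mulr0.
Qed.

End tail_events.

(** * Moments from tails *)

Section moments.
Context {d : measure_display} {T : measurableType d} {R : realType}.
Context (P : probability T R).

Lemma sum_geometric_le (x : R) n : 0 <= x < 1 ->
  \sum_(0 <= i < n) x ^+ i <= (1 - x)^-1.
Proof.
move=> /andP[x0 x1]; have x1' : 0 < 1 - x by rewrite subr_gt0.
rewrite -(ler_pM2l x1') mulfV ?gt_eqF// big_mkord -opprB mulNr -subrX1.
by rewrite opprB gerBl exprn_ge0.
Qed.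

Lemma powR2_lt1 (x : R) : x < 0 -> 2 `^ x < 1 :> R.
Proof.
move=> x0; have -> : 2 `^ x = expR (x * ln 2) :> R by rewrite /powR pnatr_eq0.
rewrite -[ltRHS]expR0 ltr_expR nmulr_rlt0//.
by apply: ln_gt0; lra.
Qed.

Lemma dyadic_bracket (x : R) : 1 <= x ->
  exists n, 2 ^+ n <= x < 2 ^+ n.+1.
Proof.
move=> x1; have x0 : 0 <= x by lra.
have /andP[x2 x3] := truncn_itv x0.
have t0 : (0 < Num.truncn x)%N by rewrite truncn_gt0.
have /andP[l u] := trunc_log_bounds (isT : 1 < 2)%N t0.
exists (trunc_log 2 (Num.truncn x)); apply/andP; split.
  by apply: le_trans x2; rewrite -natrX ler_nat.
by apply: (lt_le_trans x3); rewrite -natrX ler_nat.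
Qed.

(** Dyadic layers: f^q is at most 1 plus the sum over n of 2^(q(n+1)) on the set where f >= 2^n. The
    tail bound makes the integrals of the layers geometric with ratio 2^(q-b) < 1. *)
Lemma expectation_powR_le (b q C : R) (f : T -> R) :
  0 < q < b -> 0 <= C -> measurable_fun setT f -> (forall w, 0 <= f w) ->
  (forall u, 1 <= u -> (P [set w | (u <= f w)%R] <= (C * u `^ (- b))%:E)%E) ->
  (\int[P]_w (f w `^ q)%:E <=
    (1 + C * 2 `^ q * (1 - 2 `^ (q - b))^-1)%:E)%E.
Proof.
move=> /andP[q0 qb] C0 mf f0 Pf.
pose A n := [set w | (2 ^+ n <= f w)%R].
have mA n : measurable (A n) by exact: measurable_superlevel.
pose g n w : \bar R := ((2 `^ q * (2 `^ q) ^+ n) * \1_(A n) w)%:E.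
have c0 n : 0 <= 2 `^ q * (2 `^ q) ^+ n :> R.
  by rewrite mulr_ge0 ?powR_ge0// exprn_ge0 ?powR_ge0.
have g0 n w : (0 <= g n w)%E by rewrite lee_fin mulr_ge0// indicE.
have mg n : measurable_fun setT (g n).
  apply/measurable_EFinP; apply: measurable_funM.
    exact: measurable_cst.
  exact: measurable_indic.
have mG : measurable_fun setT (fun w => \sum_(n <oo) g n w)%E.
  by apply: ge0_emeasurable_sum => //.
apply: (@le_trans _ _ (\int[P]_w (1 + \sum_(n <oo) g n w))%E).
  apply: ge0_le_integral => //.
  - by move=> w _; rewrite lee_fin powR_ge0.
  - by apply/measurable_EFinP; exact: (measurableT_comp (measurable_powR q) mf).
  - exact: emeasurable_funD.
  - move=> w _; have [f1|f1] := leP (f w) 1.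
      apply: (@le_trans _ _ 1%E); last by rewrite leeDl// nneseries_ge0.
      rewrite lee_fin; have <- : (1 : R) `^ q = 1 by rewrite powR1.
      by apply: ge0_ler_powR => //; rewrite ?nnegrE// ltW.
    have [n /andP[n1 n2]] : exists n, 2 ^+ n <= f w < 2 ^+ n.+1.
      exact/dyadic_bracket/ltW.
    apply: (@le_trans _ _ (g n w)).
      rewrite /g indicE mem_set// mulr1 lee_fin -exprS.
      rewrite -powR_mulrn ?powR_ge0// powRAC powR_mulrn//.
      apply: ge0_ler_powR; rewrite ?nnegrE ?exprn_ge0//; exact: ltW.
    apply: (@le_trans _ _ (\sum_(n <oo) g n w)%E); last by rewrite leeDr.
    apply: le_trans (nneseries_lim_ge n.+1 _) => //.
    by rewrite big_nat_recr//= leeDr// sume_ge0.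
rewrite ge0_integralD//; last by move=> w _; exact: nneseries_ge0.
rewrite integral_cst//= probability_setT mule1 integral_nneseries// EFinD leeD2l//.
apply: (@nneseries_le_bound _ _ (fun n => C * 2 `^ q * (2 `^ (q - b)) ^+ n)).
- by move=> n; exact: integral_ge0.
- move=> n; rewrite /g; under eq_integral do rewrite EFinM.
  rewrite ge0_integralZl_EFin//; last first.
    apply/measurable_EFinP; exact: measurable_indic.
  rewrite integral_indic// setIT.
  have := Pf (2 ^+ n) (exprn_ege1 _ _).
  rewrite ler1n => /(_ isT) H.
  apply: (le_trans (lee_wpmul2l _ H)); first by rewrite lee_fin.
  rewrite -EFinM lee_fin le_eqVlt; apply/orP; left; apply/eqP.
  rewrite powRD; last by rewrite pnatr_eq0 implybT.
  rewrite exprMn -(@powR_mulrn _ 2)// (powRAC 2 n%:R) powR_mulrn ?powR_ge0//.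
  ring.
- move=> n; rewrite -mulr_sumr ler_wpM2l//.
    by rewrite mulr_ge0// powR_ge0.
  apply: sum_geometric_le; rewrite powR_ge0/=.
  by rewrite powR2_lt1// subr_lt0.
Qed.

End moments.

(** * Pairwise independence *)

Section independence.

Lemma bounded_integrable {d : measure_display} {T : measurableType d}
    {R : realType} (P : probability T R) (f : T -> R) (c : R) :
  measurable_fun setT f -> (forall w, `|f w| <= c) ->
  P.-integrable setT (EFin \o f).
Proof.
move=> mf fc; apply: (@le_integrable _ _ _ P setT measurableT _ (EFin \o cst c)).
- exact/measurable_EFinP.
- by move=> w _; rewrite /= lee_fin (le_trans (fc w))// ler_norm.
- exact: finite_measure_integrable_cst.
Qed.

Context {d : measure_display} {T : measurableType d} {R : realType}.
Context (P : probability T R).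

Definition indep_pair (V1 V2 : T -> R) := forall B1 B2 : set R,
  measurable B1 -> measurable B2 ->
  P (V1 @^-1` B1 `&` V2 @^-1` B2) = (P (V1 @^-1` B1) * P (V2 @^-1` B2))%E.

(** Independence says that the joint law and the product of the marginals agree on rectangles, hence
    everywhere by uniqueness of the product measure; Fubini then factors the integral. Boundedness
    settles all integrability questions. *)
Lemma Rintegral_indep_mul (V1 V2 : {RV P >-> R}) (g1 g2 : R -> R) (c1 c2 : R) :
  indep_pair V1 V2 ->
  measurable_fun setT g1 -> measurable_fun setT g2 ->
  (forall x, `|g1 x| <= c1) -> (forall x, `|g2 x| <= c2) ->
  \int[P]_w (g1 (V1 w) * g2 (V2 w)) =
  (\int[P]_w g1 (V1 w)) * (\int[P]_w g2 (V2 w)).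
Proof.
move=> ind mg1 mg2 gc1 gc2.
have mV : measurable_fun setT (fun w => (V1 w, V2 w)).
  exact: measurable_fun_pair.
pose m1 := distribution P V1; pose m2 := distribution P V2.
pose G (z : R * R) : \bar R := (g1 z.1 * g2 z.2)%:E.
have mg : measurable_fun setT (fun z : R * R => g1 z.1 * g2 z.2).
  apply: measurable_funM.
    exact: (measurableT_comp mg1 measurable_fst).
  exact: (measurableT_comp mg2 measurable_snd).
have gc z : `|g1 z.1 * g2 z.2| <= c1 * c2 :> R by rewrite normrM ler_pM.
have i1 : m1.-integrable setT (EFin \o g1) by exact: (bounded_integrable _ mg1 gc1).
have i2 : m2.-integrable setT (EFin \o g2) by exact: (bounded_integrable _ mg2 gc2).
have iV1 : P.-integrable setT (EFin \o g1 \o V1).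
  apply: (bounded_integrable P (f := g1 \o V1) (c := c1)).
    exact: (measurableT_comp mg1).
  by move=> w /=.
have iV2 : P.-integrable setT (EFin \o g2 \o V2).
  apply: (bounded_integrable P (f := g2 \o V2) (c := c2)).
    exact: (measurableT_comp mg2).
  by move=> w /=.
have iV : P.-integrable setT (G \o (fun w => (V1 w, V2 w))).
  apply: (bounded_integrable P (f := fun w => g1 (V1 w) * g2 (V2 w)) (c := c1 * c2)).
    apply: measurable_funM.
      exact: (measurableT_comp mg1).
    exact: (measurableT_comp mg2).
  by move=> w; exact: (gc (V1 w, V2 w)).
have mG : measurable_fun setT G by exact/measurable_EFinP.
have E1 : (\int[P]_w (g1 (V1 w))%:E = \int[m1]_x (g1 x)%:E)%E.
  by rewrite (integral_distribution (f := EFin \o g1))//; exact/measurable_EFinP.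
have E2 : (\int[P]_w (g2 (V2 w))%:E = \int[m2]_x (g2 x)%:E)%E.
  by rewrite (integral_distribution (f := EFin \o g2))//; exact/measurable_EFinP.
rewrite /Rintegral E1 E2.
have f1 : (\int[m1]_x (g1 x)%:E)%E \is a fin_num by exact: integrable_fin_num i1.
have f2 : (\int[m2]_x (g2 x)%:E)%E \is a fin_num by exact: integrable_fin_num i2.
rewrite -fineM//; congr fine.
transitivity (\int[pushforward P (fun w => (V1 w, V2 w))]_z G z)%E.
  by rewrite (integral_pushforward mV).
transitivity (\int[(m1 \x m2)%E]_z G z)%E.
  apply: eq_measure_integral => A mA _; apply/esym.
  exact: (product_measure_unique (m1 := m1) (m2 := m2)).
rewrite -integral12_prod_meas1; last first.
  apply: measurable_bounded_integrable mg _ => //.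
    rewrite -setXTT [X in (X < _)%E](product_measure1E m1 m2 measurableT measurableT).
    rewrite (_ : (_ * _)%E = 1%E) ?ltry// -[RHS]mule1.
    by congr (_ * _)%E; exact: probability_setT.
  exists (c1 * c2); split; first exact: num_real.
  by move=> M cM z _ /=; exact: le_trans (gc z) (ltW cM).
transitivity (\int[m1]_x ((g1 x)%:E * \int[m2]_y (g2 y)%:E))%E.
  apply: eq_integral => x _; rewrite /fubini_F /G /=.
  under eq_integral do rewrite EFinM.
  by rewrite (integralZl measurableT i2).
rewrite -(fineK f2); under eq_integral do rewrite muleC.
by rewrite (integralZl measurableT i1) muleC.
Qed.

Lemma integrable_EFin_sum (I : eqType) (J : seq I) (f : I -> T -> R) :
  (forall k, k \in J -> P.-integrable setT (EFin \o f k)) ->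
  P.-integrable setT (EFin \o (fun w => \sum_(k <- J) f k w)).
Proof.
elim: J => [_|k J IH fi].
  by under [X in _.-integrable _ X]funext do rewrite /= big_nil; exact: integrable0.
under [X in _.-integrable _ X]funext do rewrite /= big_cons EFinD.
apply: integrableD => //; first by apply: fi; rewrite mem_head.
by apply: IH => j jJ; apply: fi; rewrite inE jJ orbT.
Qed.

Lemma Rintegral_sum (I : eqType) (J : seq I) (f : I -> T -> R) :
  (forall k, k \in J -> P.-integrable setT (EFin \o f k)) ->
  \int[P]_w (\sum_(k <- J) f k w) = \sum_(k <- J) \int[P]_w f k w.
Proof.
elim: J => [_|k J IH fi].
  by under eq_Rintegral do rewrite big_nil; rewrite Rintegral_cst// mul0r big_nil.
have fJ j : j \in J -> P.-integrable setT (EFin \o f j).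
  by move=> jJ; apply: fi; rewrite inE jJ orbT.
under eq_Rintegral do rewrite big_cons.
rewrite RintegralD// ?IH ?big_cons//; first by apply: fi; rewrite mem_head.
exact: integrable_EFin_sum.
Qed.

(** Additivity of the variance, by peeling off one term: the cross terms integrate to 0, and the
    uniform bound keeps every product integrable. *)
Lemma Rintegral_sqr_sum (I : eqType) (J : seq I) (U : I -> T -> R) (c : R) :
  uniq J -> (forall k, measurable_fun setT (U k)) ->
  (forall k w, `|U k w| <= c) ->
  (forall j k, j \in J -> k \in J -> j != k -> \int[P]_w (U j w * U k w) = 0) ->
  \int[P]_w ((\sum_(k <- J) U k w) ^+ 2) = \sum_(k <- J) \int[P]_w (U k w ^+ 2).
Proof.
move=> uJ mU Uc; elim: J uJ => [_ _|a J IH /= /andP[aJ uJ] orth].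
  under eq_Rintegral do rewrite big_nil expr0n.
  by rewrite Rintegral_cst// mul0r big_nil.
have Sc w : `|\sum_(k <- J) U k w| <= c *+ size J.
  rewrite (le_trans (ler_norm_sum _ _ _))//.
  by elim: (J) => [|k J' IH']; rewrite ?big_nil// big_cons mulrS lerD.
have mS : measurable_fun setT (fun w => \sum_(k <- J) U k w) by exact: measurable_sum.
have prod_int (f g : T -> R) cf cg : measurable_fun setT f -> measurable_fun setT g ->
    (forall w, `|f w| <= cf) -> (forall w, `|g w| <= cg) ->
    P.-integrable setT (EFin \o (fun w => f w * g w)).
  move=> mf mg fc gc; apply: (bounded_integrable P (c := cf * cg)).
    exact: measurable_funM.
  by move=> w; rewrite normrM ler_pM.
rewrite big_cons -IH//; last first.
  by move=> j k jJ kJ; apply: orth; rewrite inE ?jJ ?kJ orbT.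
transitivity (\int[P]_w (U a w * U a w + (2 * (U a w * (\sum_(k <- J) U k w)) +
    (\sum_(k <- J) U k w) * (\sum_(k <- J) U k w)))).
  by apply: eq_Rintegral => w _; rewrite big_cons; ring.
have i1 : P.-integrable setT (EFin \o (fun w => U a w * U a w)) by exact: prod_int.
have i2 : P.-integrable setT (EFin \o (fun w => U a w * \sum_(k <- J) U k w)).
  exact: prod_int.
have i3 : P.-integrable setT (EFin \o (fun w => (\sum_(k <- J) U k w) * (\sum_(k <- J) U k w))).
  exact: prod_int.
have i2' : P.-integrable setT (EFin \o (fun w => 2 * (U a w * \sum_(k <- J) U k w))).
  by under [X in _.-integrable _ X]funext do rewrite /= EFinM; exact: integrableZl.
rewrite RintegralD//; last first.
  by under [X in _.-integrable _ X]funext do rewrite /= EFinD; exact: integrableD.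
rewrite RintegralD// RintegralZl//.
under [X in 2 * X]eq_Rintegral do rewrite mulr_sumr.
rewrite Rintegral_sum; last by move=> k _; exact: prod_int.
rewrite big_seq big1 ?mulr0 ?add0r//.
move=> k kJ; apply: orth; rewrite ?inE ?eqxx ?kJ ?orbT//.
by apply: contraNneq aJ => ->.
Qed.

End independence.

(** * Truncation *)

Section truncation.
Context {d : measure_display} {T : measurableType d} {R : realType}.
Context (P : probability T R).

Lemma EFin_Rintegral (f : T -> R) : P.-integrable setT (EFin \o f) ->
  ((\int[P]_w f w)%:E = \int[P]_w (f w)%:E)%E.
Proof. by move=> fi; rewrite /Rintegral fineK// integrable_fin_num. Qed.

Lemma Rintegral_probability_cst (r : R) : \int[P]_w r = r.
Proof. by rewrite Rintegral_cst// /= (@probability_setT _ _ _ P) mulr1. Qed.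

(** It is applied to mu_k X_k(mu_k) / t, so level 1 stands for height t. Large values are sent to 0
    rather than to 1 or -1. *)
Definition trunc1 (x : R) : R := x * \1_[set y | `|y| <= 1] x.

Lemma trunc1_in (x : R) : `|x| <= 1 -> trunc1 x = x.
Proof. by move=> x1; rewrite /trunc1 indicE mem_set// mulr1. Qed.

Lemma trunc1_out (x : R) : 1 < `|x| -> trunc1 x = 0.
Proof. by move=> x1; rewrite /trunc1 indicE memNset ?mulr0//= leNgt x1. Qed.

Lemma measurable_trunc1 : measurable_fun setT trunc1.
Proof.
apply: measurable_funM => //; apply: measurable_indic.
rewrite (_ : mkset _ = [set` `[-1, 1]]) ?measurable_itv//.
by apply/seteqP; split => x /=; rewrite in_itv/= ler_norml.
Qed.

Lemma norm_trunc1_le (x : R) : `|trunc1 x| <= 1.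
Proof.
have [x1|x1] := leP `|x| 1; first by rewrite trunc1_in.
by rewrite trunc1_out ?normr0.
Qed.

(** One q-th moment pays for both parts of a variable: the square of the truncation here, since q <=
    2, and the first power of the remainder in the next lemma, since q >= 1. *)
Lemma trunc1_sqr_le (q x : R) : q <= 2 -> trunc1 x ^+ 2 <= `|x| `^ q.
Proof.
move=> q2; have [x1|x1] := leP `|x| 1; last first.
  by rewrite trunc1_out// expr0n/= powR_ge0.
rewrite trunc1_in//; have [->|x0] := eqVneq x 0.
  by rewrite expr0n/= powR_ge0.
rewrite -[x ^+ 2]real_normK ?num_real// -powR_mulrn//.
by apply: ger_powR => //; rewrite normr_gt0 x0.
Qed.

Lemma sub_trunc1_le (q x : R) : 1 <= q -> `|x - trunc1 x| <= `|x| `^ q.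
Proof.
move=> q1; have [x1|x1] := leP `|x| 1.
  by rewrite trunc1_in// subrr normr0 powR_ge0.
by rewrite trunc1_out// subr0 le1r_powR// ltW.
Qed.

(* A weak form of the von Bahr-Esseen inequality: truncating at level 1 makes
   pairwise independence and Chebyshev's inequality sufficient. *)
Lemma fails_le_sum_indep (I : eqType) (J : seq I) (V : I -> {RV P >-> R})
    (a : I -> R) (q eps : R) :
  uniq J -> 1 <= q <= 2 -> 0 < eps ->
  (forall j k, j \in J -> k \in J -> j != k -> indep_pair P (V j) (V k)) ->
  (forall k, k \in J -> P.-integrable setT (EFin \o V k)) ->
  (forall k, k \in J -> \int[P]_w V k w = 0) ->
  (forall k, k \in J -> (\int[P]_w (`|V k w| `^ q)%:E <= (a k)%:E)%E) ->
  fails_le P ((4 / eps ^+ 2 + 4 / eps) * \sum_(k <- J) a k)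
    (fun w => `|\sum_(k <- J) V k w| < eps).
Proof.
move=> uJ /andP[q1 q2] e0 ind iV V0 Va.
have a0 k : k \in J -> 0 <= a k.
  move=> /Va; apply: contraTle => ak; rewrite -ltNge.
  apply: (@lt_le_trans _ _ 0%E); first by rewrite lte_fin.
  by apply: integral_ge0 => w _; rewrite lee_fin powR_ge0.
have mV k : measurable_fun setT (V k) by exact: measurable_funPT.
have mN k : measurable_fun setT (fun w => (`|V k w| `^ q)%:E).
  apply/measurable_EFinP; apply: (measurableT_comp (measurable_powR q)).
  exact: measurableT_comp.
pose U k w := trunc1 (V k w).
have mU k : measurable_fun setT (U k) by exact: (measurableT_comp measurable_trunc1).
have U1 k w : `|U k w| <= 1 by exact: norm_trunc1_le.
have iU k : P.-integrable setT (EFin \o U k) by exact: (bounded_integrable _ (mU k) (U1 k)).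
pose e k := \int[P]_w U k w.
have e1 k : `|e k| <= 1.
  apply: (le_trans (le_normr_Rintegral measurableT (iU k))).
  have := @le_Rintegral _ _ _ P setT (fun w => `|U k w|) (cst 1) measurableT.
  rewrite Rintegral_probability_cst; apply => //.
    apply: (bounded_integrable P (c := 1)); first exact: measurableT_comp.
    by move=> w; rewrite normr_id.
  exact: finite_measure_integrable_cst.
pose c k w := U k w - e k.
have mc k : measurable_fun setT (c k) by exact: measurable_funB.
have c2 k w : `|c k w| <= 2.
  by rewrite (le_trans (ler_normB _ _))// (natrD _ 1 1) lerD.
have ie k : P.-integrable setT (EFin \o cst (e k)).
  exact: finite_measure_integrable_cst.
have c0 k : \int[P]_w c k w = 0.
  by rewrite [LHS](RintegralB measurableT (iU k) (ie k)) [X in _ - X]Rintegral_probability_cst subrr.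
have orth j k : j \in J -> k \in J -> j != k -> \int[P]_w (c j w * c k w) = 0.
  move=> jJ kJ jk.
  have mt i : measurable_fun setT (fun x : R => trunc1 x - e i).
    by apply: measurable_funB => //; exact: measurable_trunc1.
  have t2 i x : `|trunc1 x - e i| <= 2.
    by rewrite (le_trans (ler_normB _ _))// (natrD _ 1 1) lerD// norm_trunc1_le.
  rewrite (Rintegral_indep_mul (ind _ _ jJ kJ jk) (mt j) (mt k) (t2 j) (t2 k)).
  by rewrite [X in X * _](c0 j) mul0r.
have sq_int (f : T -> R) b : measurable_fun setT f -> (forall w, `|f w| <= b) ->
    P.-integrable setT (EFin \o (fun w => f w ^+ 2)).
  move=> mf fb; apply: (bounded_integrable P (c := b ^+ 2)).
    exact: measurable_funX.
  by move=> w; rewrite normrX lerXn2r ?nnegrE// (le_trans _ (fb w)).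
have cc k : k \in J -> \int[P]_w (c k w ^+ 2) <= a k.
  move=> kJ; have iU2 := sq_int _ _ (mU k) (U1 k).
  have i2 : P.-integrable setT (EFin \o (fun w => (2 * e k) * U k w)).
    exact: (integrableZl measurableT _ (iU k)).
  have ie2 : P.-integrable setT (EFin \o cst (e k ^+ 2)).
    exact: finite_measure_integrable_cst.
  have -> : \int[P]_w (c k w ^+ 2) = \int[P]_w (U k w ^+ 2) - e k ^+ 2.
    transitivity (\int[P]_w (U k w ^+ 2 - (2 * e k) * U k w + e k ^+ 2)).
      by apply: eq_Rintegral => w _; rewrite /c; ring.
    rewrite [LHS](RintegralD measurableT (integrableB measurableT iU2 i2) ie2).
    rewrite [X in X + _](RintegralB measurableT iU2 i2).
    rewrite [X in _ - X + _](RintegralZl _ measurableT (iU k)).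
    rewrite [X in _ + X]Rintegral_probability_cst -/(e k); ring.
  apply: (@le_trans _ _ (\int[P]_w (U k w ^+ 2))); first by rewrite gerBl sqr_ge0.
  rewrite -lee_fin EFin_Rintegral//; apply: le_trans (Va _ kJ).
  apply: ge0_le_integral => //.
  - by move=> w _; rewrite lee_fin sqr_ge0.
  - by apply/measurable_EFinP; exact: measurable_funX.
  - by move=> w _; rewrite lee_fin trunc1_sqr_le.
(* The margin eps is split as eps/2 for the centred truncations, eps/4 for the remainders and eps/4
   for the means of the truncations. *)
pose A w := \sum_(k <- J) c k w.
have mA : measurable_fun setT A by exact: measurable_sum.
have iA : P.-integrable setT (EFin \o (fun w => A w ^+ 2)).
  apply: (sq_int _ (\sum_(k <- J) 2) mA) => w.
  by rewrite (le_trans (ler_norm_sum _ _ _))// ler_sum.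
have FA : fails_le P (4 / eps ^+ 2 * \sum_(k <- J) a k) (fun w => A w ^+ 2 < eps ^+ 2 / 4).
  apply: fails_le_markov.
  - exact: measurable_funX.
  - by move=> w; exact: sqr_ge0.
  - by rewrite divr_gt0// exprn_gt0.
  - rewrite -EFin_Rintegral// lee_fin (Rintegral_sqr_sum uJ mc c2 orth).
    rewrite (_ : _ * _ = \sum_(k <- J) a k); last first.
      by field; rewrite gt_eqF.
    by rewrite big_seq [leRHS]big_seq ler_sum.
pose W k w := V k w - U k w.
have mW k : measurable_fun setT (W k) by exact: measurable_funB.
have iW k : k \in J -> P.-integrable setT (EFin \o W k).
  by move=> kJ; exact: (integrableB measurableT (iV _ kJ) (iU k)).
have WV k w : `|W k w| <= `|V k w| `^ q by exact: sub_trunc1_le.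
have Wa k : k \in J -> (\int[P]_w `|W k w|%:E <= (a k)%:E)%E.
  move=> kJ; apply: le_trans (Va _ kJ); apply: ge0_le_integral => //.
  - by apply/measurable_EFinP; exact: measurableT_comp.
  - by move=> w _; rewrite lee_fin.
(* As V has mean 0, the mean of its truncation is minus the mean of its remainder. *)
have ea k : k \in J -> `|e k| <= a k.
  move=> kJ; have -> : e k = - \int[P]_w W k w.
    by rewrite [X in - X](RintegralB measurableT (iV _ kJ) (iU k)) V0// sub0r opprK.
  rewrite normrN -lee_fin (le_trans _ (Wa _ kJ))// -EFin_Rintegral.
    by rewrite lee_fin; apply: le_normr_Rintegral => //; exact: iW.
  have := iW _ kJ; apply: le_integrable => //.
    by apply/measurable_EFinP; exact: measurableT_comp.
  by move=> w _; rewrite /= normr_id.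
pose S := \sum_(k <- J) a k.
rewrite -/S mulrDl.
(* If S >= eps/4, the term 4/eps * S is already at least 1; otherwise the means of the truncations
   add up to less than eps/4. *)
have [Se|Se] := leP (eps / 4) S.
  apply: fails_le_probability_le1; rewrite -[leLHS]add0r; apply: lerD.
    rewrite mulr_ge0 ?divr_ge0 ?sqr_ge0// (le_trans _ Se)// divr_ge0// ltW//.
  by rewrite mulrAC ler_pdivlMr// mul1r mulrC -ler_pdivrMr.
pose B w := \sum_(k <- J) `|W k w|.
have FB : fails_le P (4 / eps * S) (fun w => B w < eps / 4).
  apply: fails_le_markov.
  - by apply: measurable_sum => k; exact: measurableT_comp.
  - by move=> w; exact: sumr_ge0.
  - by rewrite divr_gt0.
  - rewrite (_ : _ * _ = S); last by field; rewrite gt_eqF.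
    under eq_integral do rewrite /B -sumEFin.
    rewrite ge0_integral_sum//; last first.
      by move=> k; apply/measurable_EFinP; exact: measurableT_comp.
    by rewrite -sumEFin big_seq [leRHS]big_seq lee_sum.
apply: fails_le_mono (fails_le_and FA FB) => // w [Aw Bw].
have -> : \sum_(k <- J) V k w = A w + \sum_(k <- J) W k w + \sum_(k <- J) e k.
  by rewrite -!big_split/=; apply: eq_bigr => k _; rewrite /c /W; ring.
have A2 : `|A w| < eps / 2.
  rewrite -(@ltr_pXn2r _ 2)// ?nnegrE ?divr_ge0 ?(ltW e0)//.
  by rewrite real_normK ?num_real// expr_div_n (_ : 2 ^+ 2 = 4)// -natrX.
have W4 : `|\sum_(k <- J) W k w| < eps / 4.
  by apply: le_lt_trans Bw; exact: ler_norm_sum.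
have E4 : `|\sum_(k <- J) e k| < eps / 4.
  apply: le_lt_trans Se; apply: (le_trans (ler_norm_sum _ _ _)).
  by rewrite /S big_seq [leRHS]big_seq ler_sum.
apply: (le_lt_trans (ler_normD _ _)).
apply: (@le_lt_trans _ _ (`|A w| + `|\sum_(k <- J) W k w| + `|\sum_(k <- J) e k|)).
  by rewrite lerD2r ler_normD.
lra.
Qed.

End truncation.

(** * First moments and oscillations *)

Section process_moments.
Context {d : measure_display} {T : measurableType d} {R : realType}.
Context (P : probability T R).

Lemma ereal_sup_image_le (I : Type) (D : set I) (f : I -> \bar R) (y : \bar R) i :
  (ereal_sup [set f j | j in D] <= y)%E -> D i -> (f i <= y)%E.
Proof. by move=> fy Di; apply: le_trans fy; apply: ereal_sup_ubound; exists i. Qed.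

(* Centering gives E|f| = 2 E f^+, so the one-sided domination of (S2) suffices. *)
Lemma first_moment_le (C b : R) (f : {RV P >-> R}) : 1 < b -> 0 <= C ->
  P.-integrable setT (EFin \o f) -> \int[P]_w f w = 0 ->
  (forall u, 1 <= u -> (P [set w | (u <= f w)%R] <= (C * u `^ (- b))%:E)%E) ->
  (\int[P]_w (`|f w|)%:E <=
    (2 * (1 + C * 2 `^ 1 * (1 - 2 `^ (1 - b))^-1))%:E)%E.
Proof.
move=> b1 C0 fi f0 Pf.
have mf : measurable_fun setT f by exact: measurable_funPT.
pose g w := Num.max (f w) 0.
have mg : measurable_fun setT g by apply: measurable_maxr.
have g0 w : 0 <= g w by rewrite le_max lexx orbT.
have gi : P.-integrable setT (EFin \o g).
  apply: le_integrable fi => //; first exact/measurable_EFinP.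
  move=> w _; rewrite /= lee_fin /g; case: (leP (f w) 0) => //.
  by rewrite normr0.
have : (\int[P]_w (g w `^ 1)%:E <= (1 + C * 2 `^ 1 * (1 - 2 `^ (1 - b))^-1)%:E)%E.
  apply: (expectation_powR_le (b := b)) => //; first by rewrite ltr01.
  move=> u u1; rewrite (_ : [set w | _] = [set w | u <= f w]); first exact: Pf.
  apply/seteqP; split => w /=; rewrite /g le_max; last by move=> ->.
  by case/orP => // u0; have := lt_le_trans (lt_le_trans ltr01 u1) u0; rewrite ltxx.
under eq_integral do rewrite powRr1//.
rewrite -EFin_Rintegral// lee_fin => gK.
have ai : P.-integrable setT (EFin \o (fun w => `|f w|)).
  apply: le_integrable fi => //.
    by apply/measurable_EFinP; exact: measurableT_comp.
  by move=> w _; rewrite /= normr_id.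
rewrite -EFin_Rintegral// lee_fin.
have -> : \int[P]_w `|f w| = \int[P]_w (2 * g w - f w).
  apply: eq_Rintegral => w _; rewrite /g.
  have [h|h] := leP (f w) 0; first by rewrite ler0_norm//; ring.
  by rewrite gtr0_norm//; ring.
have g2 : P.-integrable setT (EFin \o (fun w => 2 * g w)).
  exact: (integrableZl measurableT 2 gi).
rewrite [leLHS](RintegralB measurableT g2 fi) f0 subr0.
by rewrite [leLHS](RintegralZl 2 measurableT gi) ler_pM2l.
Qed.

Context (X : nat -> R -> {RV P >-> R}).

(** The event of (S3) at level [u], in the same form, so that the measurability assumed there
    carries over to this uncountable supremum. *)
Definition oscillation (k : nat) (r m u : R) : set T :=
  [set w | (u%:E <= ereal_sup [set (`|(r + s) * X k (r + s) w - r * X k r w|)%:E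
                               | s in `[0%R, m]%classic])%E].

Lemma not_oscillation (k : nat) (r m u s : R) (w : T) :
  ~ oscillation k r m u w -> 0 <= s <= m ->
  `|(r + s) * X k (r + s) w - r * X k r w| < u.
Proof.
move=> /negP; rewrite -ltNge => osc sm; rewrite -lte_fin.
by apply: le_lt_trans osc; apply: ereal_sup_ubound; exists s; rewrite //= in_itv.
Qed.

(* Letting the base point r tend to 0 in the oscillation bound removes the term
   r X_k(r), which is small in probability because the first moments are
   bounded. *)
Lemma weak_tail (b C K : R) (k : nat) (m u : R) :
  0 <= C -> 1 < b ->
  (forall m, 0 < m -> (\int[P]_w (`|X k m w|)%:E <= K%:E)%E) ->
  (forall t r m, 0 < t -> 0 < r -> 0 < m ->
    measurable (oscillation k r m t) /\
    (P (oscillation k r m t) <= (C * m `^ b / t `^ b)%:E)%E) ->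
  0 < m -> 0 < u ->
  (P [set w | (u <= `|X k m w|)%R] <= (C * 2 `^ b * u `^ (- b))%:E)%E.
Proof.
move=> C0 b1 XK osc m0 u0.
have mX k' m' : measurable_fun setT (X k' m') by exact: measurable_funPT.
have maX m' : measurable_fun setT (fun w => `|X k m' w|) by exact: measurableT_comp.
have K0 : 0 <= K.
  by rewrite -lee_fin; apply: le_trans (XK _ ltr01); apply: integral_ge0.
apply/lee_addgt0Pr => e e0.
pose h := m * u / 2.
have h0 : 0 < h by rewrite /h divr_gt0// mulr_gt0.
(* The first bound keeps r below m; the second makes Markov's estimate r K / h for r |X_k(r)| at
   most e. Using K + 1 avoids division by zero. *)
pose r := Num.min (m / 2) (e * h / (K + 1)).
have K1 : 0 < K + 1 by rewrite ltr_wpDl.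
have r0 : 0 < r by rewrite lt_min !divr_gt0// mulr_gt0.
have rm : r <= m / 2 by rewrite ge_min lexx.
have rK : r <= e * h / (K + 1) by rewrite ge_min lexx orbT.
have mr : 0 < m - r by rewrite subr_gt0; apply: (le_lt_trans rm); rewrite ltr_pdivrMr// ltr_pMr// ltr1n.
have [mo Po] := osc h r (m - r) h0 r0 mr.
have F1 : fails_le P (C * m `^ b / h `^ b)
    (fun w => `|m * X k m w - r * X k r w| < h).
  exists (oscillation k r (m - r) h); split => //.
    apply: le_trans Po _; rewrite lee_fin ler_wpM2r ?invr_ge0 ?powR_ge0//.
    rewrite ler_wpM2l// ge0_ler_powR ?nnegrE ?(ltW mr) ?(ltW m0) ?gerBl ?(ltW r0)//.
    by rewrite (le_trans ler01)// ltW.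
  move=> w nosc; have := @not_oscillation k r (m - r) h (m - r) w nosc.
  rewrite subrKC; apply.
  by rewrite (ltW mr) lexx.
have F2 : fails_le P e (fun w => r * `|X k r w| < h).
  have F2' : fails_le P e (fun w => `|X k r w| < h / r).
    apply: fails_le_markov => //; first by rewrite divr_gt0.
    apply: le_trans (XK _ r0) _; rewrite lee_fin.
    rewrite mulrAC ler_pdivlMr// mulrC.
    rewrite ler_pdivlMr// in rK; rewrite [leRHS]mulrC; apply: le_trans rK.
    by rewrite ler_pM2l// lerDl.
  by apply: fails_le_mono F2' => // w; rewrite ltr_pdivlMr// mulrC.
have [F [mF PF FG]] := fails_le_and F1 F2.
have -> : C * 2 `^ b * u `^ (- b) = C * m `^ b / h `^ b.
  have -> : h = m * (u * 2^-1) by rewrite /h mulrA.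
  rewrite !powRM ?mulr_ge0 ?(ltW m0) ?(ltW u0)// powRN.
  have -> : (2^-1) `^ b = (2 `^ b)^-1 :> R by rewrite -powRN -powR_inv1// -powRrM mulN1r.
  by field; rewrite !gt_eqF ?powR_gt0.
rewrite -EFinD; apply: le_trans PF; apply: le_measure; rewrite ?inE//.
  exact: measurable_superlevel.
move=> w /= uX; apply: contrapT => /FG[G1 G2].
have : m * u < m * u.
  apply: (@le_lt_trans _ _ (m * `|X k m w|)); first by rewrite ler_pM2l.
  rewrite -{1}(gtr0_norm m0) -normrM.
  have -> : m * X k m w = (m * X k m w - r * X k r w) + r * X k r w by ring.
  apply: (le_lt_trans (ler_normD _ _)).
  rewrite [X in _ + X]normrM (gtr0_norm r0) (_ : m * u = h + h) ?ltrD//.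
  by rewrite /h; field.
by rewrite ltxx.
Qed.

End process_moments.

(** * Power inequalities for small and for large masses *)

Section power_bounds.
Context {R : realType}.

(** Split off one factor x/t, to be summed over the masses, and use x/t <= t^(-eta) in the other q -
    1 powers. *)
Lemma powR_small_mass (x t eta q : R) : 0 <= x -> 0 < t -> 1 <= q ->
  x <= t `^ (1 - eta) -> (x / t) `^ q <= x / t * t `^ (- (eta * (q - 1))).
Proof.
move=> x0 t0 q1 xt.
have xt0 : 0 <= x / t by rewrite divr_ge0// ltW.
rewrite -mulr_powRB1//; last by rewrite (lt_le_trans ltr01).
rewrite ler_wpM2l// -mulNr powRrM ge0_ler_powR ?nnegrE ?powR_ge0 ?subr_ge0//.
rewrite ler_pdivrMr// (le_trans xt)// mulrC -{2}(powRr1 (ltW t0)) -powRD//.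
by rewrite (gt_eqF t0) implybT.
Qed.

(** With eta = delta / (2 (1 + delta)) one has (1 - eta) (1 + delta) = 1 + delta/2, so x^(1 + delta)
    >= t^(1 + delta/2). The factor x/t is again the one to be summed. *)
Lemma powR_large_mass (x t delta : R) : 0 < t -> 0 < delta -> 0 < x ->
  t `^ (1 - delta / (2 * (1 + delta))) <= x ->
  (x `^ delta)^-1 <= x / t * t `^ (- (delta / 2)).
Proof.
move=> t0 d0 x0 tx.
have d1 : 0 < 1 + delta by rewrite addr_gt0.
have H : t * t `^ (delta / 2) <= x * x `^ delta.
  have -> : x * x `^ delta = x `^ (1 + delta).
    by rewrite powRD ?powRr1 ?(ltW x0)// (gt_eqF x0) implybT.
  have -> : t * t `^ (delta / 2) = (t `^ (1 - delta / (2 * (1 + delta)))) `^ (1 + delta).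
    rewrite -powRrM -{1}(powRr1 (ltW t0)) -powRD; last by rewrite (gt_eqF t0) implybT.
    by congr (_ `^ _); field; rewrite gt_eqF.
  by rewrite ge0_ler_powR ?nnegrE ?powR_ge0 ?(ltW d1) ?(ltW x0).
rewrite powRN -mulrA -invfM ler_pdivlMr ?mulr_gt0 ?powR_gt0//.
by rewrite ler_pdivrMl ?powR_gt0// [leRHS]mulrC.
Qed.

End power_bounds.

(** * Oscillations and moments with a common exponent *)

Section process.
Context {d : measure_display} {T : measurableType d} {R : realType}.
Context (P : probability T R) (X : nat -> R -> {RV P >-> R}).

(** For m <= t, lowering the exponent only enlarges the bound; for m > t the bound exceeds 1, which
    is why the constant is at least 1. *)
Lemma oscillation_exponent (C b q : R) (k : nat) (r m t : R) :
  0 < q <= b -> 0 < m -> 0 < t -> measurable (oscillation X k r m t) ->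
  (P (oscillation X k r m t) <= (C * m `^ b / t `^ b)%:E)%E ->
  (P (oscillation X k r m t) <= (Num.max C 1 * (m / t) `^ q)%:E)%E.
Proof.
move=> /andP[q0 qb] m0 t0 mo Po.
have b0 : 0 < b := lt_le_trans q0 qb.
have mt0 : 0 < m / t by rewrite divr_gt0.
have M0 : 0 <= Num.max C 1 by rewrite le_max ler01 orbT.
have [mt|mt] := leP (m / t) 1.
  apply: le_trans Po _; rewrite lee_fin.
  have -> : C * m `^ b / t `^ b = C * (m / t) `^ b.
    rewrite powRM ?invr_ge0 ?(ltW m0) ?(ltW t0)// -mulrA; congr (_ * (_ * _)).
    by rewrite -powRN -powR_inv1 ?(ltW t0)// -powRrM mulN1r.
  apply: (@le_trans _ _ (Num.max C 1 * (m / t) `^ b)).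
    by rewrite ler_wpM2r ?powR_ge0// le_max lexx.
  by rewrite ler_wpM2l// ger_powR// mt0.
apply: (@le_trans _ _ 1%E); first exact: probability_le1.
rewrite lee_fin -[leLHS]mulr1 ler_pM// ?le_max ?lexx ?orbT//.
have -> : 1 = (m / t) `^ 0 :> R by rewrite powRr0.
by rewrite ler_powR// ltW.
Qed.

Lemma fails_le_moment (K q r u : R) (f : T -> R) : measurable_fun setT f ->
  0 < q -> 0 < r -> 0 < u -> (\int[P]_w (`|f w| `^ q)%:E <= K%:E)%E ->
  fails_le P (K * (r / u) `^ q) (fun w => `|r * f w| < u).
Proof.
move=> mf q0 r0 u0 fK.
have ur : 0 < u / r by rewrite divr_gt0.
have : fails_le P (K * (r / u) `^ q) (fun w => `|f w| `^ q < (u / r) `^ q).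
  apply: fails_le_markov.
  - by apply: (measurableT_comp (measurable_powR q)); exact: measurableT_comp.
  - by move=> w; exact: powR_ge0.
  - exact: powR_gt0.
  - have E : u / r * (r / u) = 1 by field; rewrite !gt_eqF.
    by rewrite mulrCA -powRM ?divr_ge0 ?(ltW r0) ?(ltW u0)// E powR1 mulr1.
apply: fails_le_mono => // w fw.
rewrite normrM (gtr0_norm r0) mulrC -ltr_pdivlMr// ltNge; apply/negP => fu.
by have := ge0_ler_powR (ltW q0) (ltW ur : _ \in Num.nneg) (normr_ge0 _ : _ \in Num.nneg) fu; rewrite leNgt fw.
Qed.

(* Dyadic decomposition of (0, lam]: on [lam/2^(n+1), lam/2^n] use the
   oscillation bound based at the left end point. *)
Lemma fails_le_near0 (C K q : R) (k : nat) (lam u : R) :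
  0 <= C -> 0 <= K -> 1 < q -> 0 < lam -> 0 < u ->
  (forall m, 0 < m -> (\int[P]_w (`|X k m w| `^ q)%:E <= K%:E)%E) ->
  (forall r m, 0 < r -> 0 < m -> fails_le P (C * (m / u) `^ q)
     (fun w => ~ oscillation X k r m u w)) ->
  fails_le P ((C + K) * (lam / u) `^ q)
    (fun w => forall s, 0 < s <= lam -> `|s * X k s w| < u + u).
Proof.
move=> C0 K0 q1 lam0 u0 XK osc.
have q0 : 0 < q := lt_trans ltr01 q1.
pose rn n : R := lam * 2^-1 ^+ n.+1.
have rn0 n : 0 < rn n by rewrite mulr_gt0// exprn_gt0.
(* Only the factor 2^-(n+1) is kept, not its q-th power: these factors sum to at most 1, so the
   constant stays C + K. *)
have Fn n : fails_le P ((C + K) * (lam / u) `^ q * 2^-1 ^+ n.+1)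
    (fun w => ~ oscillation X k (rn n) (rn n) u w /\ `|rn n * X k (rn n) w| < u).
  have mX : measurable_fun setT (X k (rn n)) by exact: measurable_funPT.
  apply: fails_le_mono (fails_le_and (osc _ _ (rn0 n) (rn0 n))
    (fails_le_moment mX q0 (rn0 n) u0 (XK _ (rn0 n)))) => //.
  rewrite -mulrDl -mulrA ler_wpM2l ?addr_ge0//.
  rewrite /rn mulrAC (@powRM _ (lam / u)) ?divr_ge0 ?exprn_ge0 ?(ltW lam0) ?(ltW u0)//.
  rewrite ler_wpM2l ?powR_ge0// ge1r_powR ?(ltW q1)// exprn_gt0//=.
  by rewrite exprn_ile1// invf_le1// ler1n.
apply: fails_le_mono (fails_le_countable Fn (S := (C + K) * (lam / u) `^ q) _) => //.
  move=> w Hw s /andP[s0 slam].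
  have [n /andP[n1 n2]] : exists n, 2 ^+ n <= lam / s < 2 ^+ n.+1.
    by apply: dyadic_bracket; rewrite ler_pdivlMr// mul1r.
  have [nosc rX] := Hw n.
  have rs : rn n <= s.
    rewrite /rn exprVn ler_pdivrMr ?exprn_gt0//.
    by rewrite ltr_pdivrMr// mulrC in n2; exact: ltW.
  have sr : s <= rn n + rn n.
    have -> : rn n + rn n = lam / 2 ^+ n.
      by rewrite /rn exprVn exprS; field; rewrite expf_neq0.
    by rewrite ler_pdivlMr ?exprn_gt0// mulrC -ler_pdivlMr.
  have := @not_oscillation _ _ _ P X k (rn n) (rn n) u (s - rn n) w nosc.
  rewrite subrKC subr_ge0 rs lerBlDr sr => /(_ isT) H.
  rewrite -[s * _](subrK (rn n * X k (rn n) w)).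
  by apply: (le_lt_trans (ler_normD _ _)); rewrite ltrD.
move=> n; rewrite -mulr_sumr -[leRHS]mulr1 ler_wpM2l ?mulr_ge0 ?addr_ge0 ?powR_ge0//.
under eq_bigr do rewrite exprS.
rewrite -mulr_sumr.
have := @sum_geometric_le R 2^-1 n; rewrite invr_ge0 ler0n invf_lt1// ltr1n => /(_ isT) H.
rewrite ler_pdivrMl// mulr1 (le_trans H)//.
by rewrite (_ : (1 - 2^-1)^-1 = 2 :> R)//; field.
Qed.

End process.

(** * Weighted sums *)

Section law_of_large_numbers.
Context {d : measure_display} {T : measurableType d} {R : realType}.
Context (P : probability T R) (X : nat -> R -> {RV P >-> R}).

Lemma indep_pair_scale (a b : R) (V W : T -> R) :
  indep_pair P V W -> indep_pair P (fun w => a * V w) (fun w => b * W w).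
Proof.
move=> ind B1 B2 mB1 mB2.
have mM (c : R) B : measurable B -> measurable ((fun x : R => c * x) @^-1` B).
  move=> mB; rewrite -[X in measurable X]setTI.
  have mc : measurable_fun setT (fun x : R => c * x) by exact: measurable_funM.
  exact: mc.
exact: (ind _ _ (mM a _ mB1) (mM b _ mB2)).
Qed.

(** The rate c precedes eps because it depends on delta and q only; one grid can then serve every
    eps. Free [J] and [mu] let the bound cover both completed masses and a single partial one. *)
Lemma fails_le_weighted_sum (q K delta : R) :
  1 < q <= 2 -> 0 <= K -> 0 < delta ->
  (forall k m, (0 < k)%N -> 0 < m -> P.-integrable setT (EFin \o X k m)) ->
  (forall k m, (0 < k)%N -> 0 < m -> \int[P]_w X k m w = 0) ->
  (forall k m, (0 < k)%N -> 0 < m -> (\int[P]_w (`|X k m w| `^ q)%:E <= K%:E)%E) ->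
  (forall j k m n, (0 < j)%N -> (0 < k)%N -> j != k -> 0 < m -> 0 < n ->
     indep_pair P (X j m) (X k n)) ->
  (forall eps, 0 < eps -> exists2 C : R, 0 <= C & forall k m, (0 < k)%N -> 0 < m ->
     (P [set w | (eps < `|X k m w|)%R] <= (C / m `^ delta)%:E)%E) ->
  exists2 c : R, 0 < c & forall eps, 0 < eps -> exists2 C : R, 0 <= C &
    forall (t : R) (J : seq nat) (mu : nat -> R), 1 <= t -> uniq J ->
      (forall k, k \in J -> (0 < k)%N) -> (forall k, k \in J -> 0 < mu k) ->
      \sum_(k <- J) mu k <= t ->
      fails_le P (C * t `^ (- c))
        (fun w => `|\sum_(k <- J) mu k * X k (mu k) w| < eps * t).
Proof.
move=> /andP[q1 q2] K0 d0 iX X0 XK ind S1.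
pose eta := delta / (2 * (1 + delta)).
have eta0 : 0 < eta by rewrite divr_gt0// mulr_gt0// addr_gt0.
(* The decay exponents obtained for large and for small masses. *)
pose c := Num.min (delta / 2) (eta * (q - 1)).
have cd : c <= delta / 2 by rewrite ge_min lexx.
have cq : c <= eta * (q - 1) by rewrite ge_min lexx orbT.
exists c; first by rewrite lt_min divr_gt0// mulr_gt0// subr_gt0.
move=> eps eps0; have e20 : 0 < eps / 2 by rewrite divr_gt0.
have [C C0 S1C] := S1 _ e20.
pose D := 4 / (eps / 2) ^+ 2 + 4 / (eps / 2).
have D0 : 0 <= D by rewrite addr_ge0// divr_ge0 ?exprn_ge0 ?(ltW e20).
exists (D * K + C); first by rewrite addr_ge0// mulr_ge0.
move=> t J mu t1 uJ Jpos mupos muJ.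
have t0 : 0 < t := lt_le_trans ltr01 t1.
have tc x : c <= x -> t `^ (- x) <= t `^ (- c) by move=> cx; rewrite ler_powR// lerN2.
pose small k := mu k <= t `^ (1 - eta).
pose Js := [seq k <- J | small k]; pose Jb := [seq k <- J | ~~ small k].
have mV k : measurable_fun setT (fun w => mu k / t * X k (mu k) w).
  by apply: measurable_funM => //; exact: measurable_funPT.
pose V k : {RV P >-> R} := mfun_Sub (mem_set (mV k)).
have xge0 k : k \in J -> 0 <= mu k / t by move=> /mupos m0; rewrite divr_ge0// ltW.
have sub_le (p : pred nat) : \sum_(k <- [seq k <- J | p k]) mu k / t <= 1.
  apply: (@le_trans _ _ (\sum_(k <- J) mu k / t)).
    rewrite big_filter [leRHS](bigID p)/= lerDl big_seq_cond sumr_ge0//.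
    by move=> k /andP[kJ _]; exact: xge0.
  by rewrite -mulr_suml ler_pdivrMr// mul1r.
have Fs : fails_le P (D * K * t `^ (- c)) (fun w => `|\sum_(k <- Js) V k w| < eps / 2).
  have H := @fails_le_sum_indep _ _ _ P _ Js V
    (fun k => K * (mu k / t) `^ q) q (eps / 2) (filter_uniq _ uJ).
  apply: fails_le_mono (H _ e20 _ _ _ _) => //.
  - rewrite -/D -mulrA ler_wpM2l// -mulr_sumr ler_wpM2l//.
    apply: (@le_trans _ _ (\sum_(k <- Js) mu k / t * t `^ (- c))).
      rewrite big_seq [leRHS]big_seq ler_sum// => k.
      rewrite mem_filter => /andP[sk kJ].
      apply: (le_trans (powR_small_mass _ _ _ sk)) => //; [exact/ltW/mupos|exact: ltW|].
      by rewrite ler_wpM2l ?xge0// tc.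
    by rewrite -mulr_suml -[leRHS]mul1r ler_wpM2r ?powR_ge0//; exact: sub_le.
  - by rewrite (ltW q1).
  - move=> j k; rewrite !mem_filter => /andP[_ jJ] /andP[_ kJ] jk.
    by apply: indep_pair_scale; apply: ind => //; rewrite ?Jpos ?mupos.
  - move=> k; rewrite mem_filter => /andP[_ kJ].
    by apply: (integrableZl measurableT (mu k / t) (iX k (mu k) _ _)); [exact: Jpos|exact: mupos].
  - move=> k; rewrite mem_filter => /andP[_ kJ].
    have iXk := iX _ _ (Jpos _ kJ) (mupos _ kJ).
    rewrite [LHS](RintegralZl (mu k / t) measurableT iXk).
    by rewrite [X in _ * X]X0 ?mulr0//; [exact: Jpos|exact: mupos].
  - move=> k; rewrite mem_filter => /andP[_ kJ] /=.
    under eq_integral do rewrite normrM (ger0_norm (xge0 _ kJ)) powRM ?xge0// mulrC EFinM.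
    have mN : measurable_fun setT (fun w => (`|X k (mu k) w| `^ q)%:E).
      apply/measurable_EFinP; apply: (measurableT_comp (measurable_powR q)).
      by apply: measurableT_comp => //; exact: measurable_funPT.
    under eq_integral do rewrite muleC.
    rewrite ge0_integralZl_EFin ?powR_ge0//.
    rewrite (mulrC K) EFinM lee_wpmul2l ?lee_fin ?powR_ge0//.
    by apply: XK; [exact: Jpos|exact: mupos].
(* For large masses each |X_k(mu_k)| is made small separately; as the masses total at most t, their
   weighted sum is then at most t eps/2. *)
have Fb : fails_le P (C * t `^ (- c)) (fun w => forall k, k \in Jb -> `|X k (mu k) w| <= eps / 2).
  have : fails_le P (\sum_(k <- Jb) C * (mu k / t * t `^ (- c)))
     (fun w => forall k, k \in Jb -> `|X k (mu k) w| <= eps / 2).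
    apply: fails_le_seq => k; rewrite mem_filter => /andP[sk kJ].
    exists [set w | (eps / 2 < `|X k (mu k) w|)%R]; split.
    - rewrite (_ : mkset _ = (fun w => `|X k (mu k) w|) @^-1` `]eps / 2, +oo[); last first.
        by apply/seteqP; split => w /=; rewrite in_itv/= andbT.
      rewrite -[X in measurable X]setTI.
      have mN : measurable_fun setT (fun w => `|X k (mu k) w|).
        by apply: measurableT_comp => //; exact: measurable_funPT.
      exact: mN.
    - apply: (le_trans (S1C _ _ (Jpos _ kJ) (mupos _ kJ))).
      rewrite lee_fin ler_wpM2l//.
      apply: (le_trans (powR_large_mass t0 d0 (mupos _ kJ) _)).
        by move: sk; rewrite /small -ltNge => /ltW.
      by rewrite ler_wpM2l ?xge0// tc.
    - by move=> w /= /negP; rewrite -leNgt.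
  apply: fails_le_mono => //.
  rewrite -mulr_sumr ler_wpM2l// -mulr_suml -[leRHS]mul1r.
  by rewrite ler_wpM2r ?powR_ge0//; exact: sub_le.
rewrite mulrDl; apply: fails_le_mono (fails_le_and Fs Fb) => // w [ws wb].
have -> : \sum_(k <- J) mu k * X k (mu k) w =
    t * (\sum_(k <- Js) V k w) + \sum_(k <- Jb) mu k * X k (mu k) w.
  rewrite (bigID small)/= -[X in X + _]big_filter -[X in _ + X]big_filter; congr (_ + _).
  rewrite mulr_sumr; apply: eq_bigr => k _ /=.
  by field; rewrite gt_eqF.
apply: (le_lt_trans (ler_normD _ _)).
have H1 : `|t * (\sum_(k <- Js) V k w)| < t * (eps / 2).
  by rewrite normrM (gtr0_norm t0) ltr_pM2l.
have H2 : `|\sum_(k <- Jb) mu k * X k (mu k) w| <= t * (eps / 2).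
  apply: (le_trans (ler_norm_sum _ _ _)).
  apply: (@le_trans _ _ (\sum_(k <- Jb) mu k * (eps / 2))).
    rewrite big_seq [leRHS]big_seq ler_sum// => k kJb; rewrite normrM.
    have m0 : 0 < mu k by apply: mupos; move: kJb; rewrite mem_filter => /andP[].
    by rewrite (gtr0_norm m0) ler_pM2l// wb.
  rewrite -mulr_suml ler_wpM2r ?(ltW e20)//.
  by have := sub_le (fun k => ~~ small k); rewrite -mulr_suml ler_pdivrMr// mul1r.
rewrite (_ : eps * t = t * (eps / 2) + t * (eps / 2)); first by rewrite ltr_leD.
by field.
Qed.

End law_of_large_numbers.

(** * The clock and one window of time *)

Section clock.
Context {R : realType}.
Context (mk : nat -> R) (mk0 : forall k, (0 < k)%N -> 0 < mk k)
  (mkoo : Msum mk n @[n --> \oo] --> +oo).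

Lemma Msum0 : Msum mk 0 = 0.
Proof. by rewrite /Msum big_geq. Qed.

Lemma MsumS n : Msum mk n.+1 = Msum mk n + mk n.+1.
Proof. by rewrite /Msum big_nat_recr. Qed.

Lemma Msum_add i j : (i <= j)%N ->
  Msum mk j = Msum mk i + \sum_(i.+1 <= k < j.+1) mk k.
Proof. by move=> ij; rewrite /Msum (@big_cat_nat _ _ _ i.+1). Qed.

Lemma Msum_le i j : (i <= j)%N -> Msum mk i <= Msum mk j.
Proof.
move=> ij; rewrite (Msum_add ij) lerDl big_nat sumr_ge0// => k /andP[ik _].
by apply/ltW/mk0; exact: leq_ltn_trans ik.
Qed.

(** Divergence of the partial sums makes the defining set nonempty, so the default value 0 of [xget]
    is never the reason for a value of [ell]. *)
Lemma ellP t : t <= Msum mk (ell mk t) /\ forall j, t <= Msum mk j -> (ell mk t <= j)%N.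
Proof.
apply: (@xgetPex _ 0%N [set l | t <= Msum mk l /\ forall j, t <= Msum mk j -> (l <= j)%N]).
have ex : exists n, t <= Msum mk n.
  have /cvgryPge/(_ t)[N _ /(_ N (leqnn _))] := mkoo.
  by exists N.
by have [n n1 n2] := ex_minnP ex; exists n.
Qed.

Lemma le_Msum_ell t : t <= Msum mk (ell mk t).
Proof. by have [] := ellP t. Qed.

Lemma ell_min t j : t <= Msum mk j -> (ell mk t <= j)%N.
Proof. by have [_] := ellP t; apply. Qed.

Lemma Msum_lt t j : (j < ell mk t)%N -> Msum mk j < t.
Proof. by move=> jt; rewrite ltNge; apply/negP => /ell_min; rewrite leqNgt jt. Qed.

Lemma ell_gt0 t : 0 < t -> (0 < ell mk t)%N.
Proof.
move=> t0; rewrite lt0n; apply/eqP => l0.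
by have := le_Msum_ell t; rewrite l0 Msum0 leNgt t0.
Qed.

Lemma ell_le s t : s <= t -> (ell mk s <= ell mk t)%N.
Proof. by move=> st; apply: ell_min; apply: le_trans (le_Msum_ell t). Qed.

Lemma tbar_gt0 t : 0 < t -> 0 < tbar mk t.
Proof. by move=> t0; rewrite subr_gt0 Msum_lt// prednK// ell_gt0. Qed.

Lemma tbar_le t : 0 < t -> tbar mk t <= mk (ell mk t).
Proof.
move=> t0; rewrite lerBlDl; have := le_Msum_ell t.
by case: (ell mk t) (ell_gt0 t0) => // n _; rewrite MsumS.
Qed.

(** The masses strictly between the two indices start at or after time a, since [Msum mk (ell mk a)]
    is at least a, and end before b. *)
Lemma sum_between_le a b :
  a <= b -> \sum_((ell mk a).+1 <= k < ell mk b) mk k <= b - a.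
Proof.
move=> ab; have [ba|] := leqP (ell mk b) (ell mk a).
  by rewrite big_geq ?subr_ge0// (leq_trans ba).
case E : (ell mk b) => [//|n] /= an.
have nb : Msum mk n < b by apply: Msum_lt; rewrite E.
have := le_Msum_ell a; rewrite (Msum_add (an : (ell mk a <= n)%N)) in nb.
lra.
Qed.

(* [t * S_t] along one sample path [x]. *)
Definition Zt (x : nat -> R -> R) (t : R) : R :=
  \sum_(1 <= k < ell mk t) mk k * x k (mk k) + tbar mk t * x (ell mk t) (tbar mk t).

(** Deterministic core, on one path. The blocks before the one running at a contribute e, that block
    2e, the complete blocks after it e, and the block running at t another 2e: hence the 6. If a and
    t share a block, 3e is enough. *)
Lemma Zt_window (x : nat -> R -> R) (a b e : R) : 0 < a <= b ->
  `|\sum_(1 <= k < ell mk a) mk k * x k (mk k)| < e ->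
  `|tbar mk a * x (ell mk a) (tbar mk a)| < e ->
  (forall s, 0 <= s <= b - a ->
    `|(tbar mk a + s) * x (ell mk a) (tbar mk a + s) -
      tbar mk a * x (ell mk a) (tbar mk a)| < e) ->
  (forall s, 0 < s <= b - a -> `|s * x (ell mk b) s| < e + e) ->
  (forall k, (ell mk a < k < ell mk b)%N -> forall s, 0 < s <= mk k -> `|s * x k s| < e + e) ->
  \sum_((ell mk a).+1 <= k < ell mk b) mk k * `|x k (mk k)| < e ->
  forall t, a <= t <= b -> `|Zt x t| < 6 * e.
Proof.
move=> /andP[a0 ab] HA HC HD0 HD1 HDk HB t /andP[at_ tb].
have t0 : 0 < t := lt_le_trans a0 at_.
set k0 := ell mk a in HA HC HD0 HDk HB *; set r := tbar mk a in HC HD0.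
have first_piece s : 0 <= s <= b - a -> `|(r + s) * x k0 (r + s)| < e + e.
  move=> /HD0 H; rewrite -[(r + s) * _](subrK (r * x k0 r)).
  by apply: (le_lt_trans (ler_normD _ _)); rewrite ltrD.
have k0l : (k0 <= ell mk t)%N by exact: ell_le.
have lk1 : (ell mk t <= ell mk b)%N by exact: ell_le.
have k0pos : (0 < k0)%N by exact: ell_gt0.
have rE : r = a - Msum mk k0.-1 by [].
move: k0l; rewrite leq_eqVlt => /predU1P[k0E|k0l].
  have tE : tbar mk t = r + (t - a) by rewrite rE /tbar -k0E; ring.
  have := @first_piece (t - a); rewrite subr_ge0 at_ lerD2r tb -tE => /(_ isT) H.
  rewrite /Zt -k0E; apply: (le_lt_trans (ler_normD _ _)).
  by have e0 : 0 < e := le_lt_trans (normr_ge0 _) HA; lra.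
have ak0 : a <= Msum mk k0 by exact: le_Msum_ell.
have k0b : Msum mk k0 < b by apply: lt_le_trans tb; exact: Msum_lt.
have H1 : `|mk k0 * x k0 (mk k0)| < e + e.
  have -> : mk k0 = r + (Msum mk k0 - a).
    by have := MsumS k0.-1; rewrite prednK// => E; rewrite rE E; ring.
  by apply: first_piece; rewrite subr_ge0 ak0 lerD2r ltW.
(* The block running at t is either that of b, whose elapsed part is at most b - a because it starts
   no earlier than a, or a block inside the window. *)
have H2 : `|tbar mk t * x (ell mk t) (tbar mk t)| < e + e.
  move: lk1; rewrite leq_eqVlt => /predU1P[lE|lk1].
    rewrite lE; apply: HD1; rewrite tbar_gt0//= /tbar.
    have : Msum mk k0 <= Msum mk (ell mk t).-1 by apply: Msum_le; rewrite -ltnS prednK// (leq_trans _ k0l).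
    lra.
  by apply: HDk; rewrite ?k0l// tbar_gt0//= tbar_le.
have H3 : `|\sum_(k0.+1 <= k < ell mk t) mk k * x k (mk k)| < e.
  apply: le_lt_trans HB; apply: (le_trans (ler_norm_sum _ _ _)).
  rewrite [leRHS](@big_cat_nat _ _ _ (ell mk t))//= -[leLHS]addr0 lerD//.
    rewrite big_nat [leRHS]big_nat ler_sum// => k /andP[kk _].
    by rewrite normrM gtr0_norm// mk0//; exact: leq_ltn_trans kk.
  rewrite big_nat sumr_ge0// => k /andP[kk _]; rewrite mulr_ge0// ltW// mk0//.
  by apply: leq_trans kk; exact: leq_ltn_trans k0l.
rewrite /Zt (@big_cat_nat _ _ _ k0)//=; last exact: ltnW.
rewrite [X in _ + X + _]big_ltn//.
move: HA H1 H2 H3; set A := \sum_(1 <= k < k0) _; set B := mk k0 * _; set C := tbar mk t * _.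
set D := \sum_(k0.+1 <= k < ell mk t) _ => HA H1 H2 H3.
have := ler_normD (A + (B + D)) C; have := ler_normD A (B + D); have := ler_normD B D.
lra.
Qed.

Lemma St_Zt {d : measure_display} {T : measurableType d} (X : nat -> R -> T -> R) t w :
  St X mk t w = Zt (fun k s => X k s w) t / t.
Proof.
rewrite /St /Zt [RHS]mulrDl [in RHS]mulr_suml; congr (_ + _); last by rewrite mulrAC.
by apply: eq_bigr => k _; rewrite mulrAC.
Qed.

Context {d : measure_display} {T : measurableType d}.
Context (P : probability T R) (X : nat -> R -> {RV P >-> R}).

(* Markov's inequality for the q-th moment after |x| <= u + u^(1-q) |x|^q, with
   [u = e / (2 h)]. *)
Lemma fails_le_increment (q K e h : R) (J : seq nat) :
  1 < q -> 0 <= K -> 0 < e -> 0 < h ->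
  (forall k, k \in J -> (0 < k)%N) ->
  (forall k m, (0 < k)%N -> 0 < m -> (\int[P]_w (`|X k m w| `^ q)%:E <= K%:E)%E) ->
  \sum_(k <- J) mk k <= h ->
  fails_le P (K * 2 `^ q * (h / e) `^ q)
    (fun w => \sum_(k <- J) mk k * `|X k (mk k) w| < e).
Proof.
move=> q1 K0 e0 h0 Jpos XK Jh.
have q0 : 0 < q := lt_trans ltr01 q1.
pose u := e / (2 * h).
have u0 : 0 < u by rewrite divr_gt0// mulr_gt0.
have mN k : measurable_fun setT (fun w => `|X k (mk k) w| `^ q).
  apply: (measurableT_comp (measurable_powR q)).
  by apply: measurableT_comp => //; exact: measurable_funPT.
have mJ k : k \in J -> 0 <= mk k by move=> kJ; apply/ltW/mk0/Jpos.
(* The maximum with 0 makes the summands nonnegative at every index, as the exchange of sum and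
   integral asks; on [J] it equals [mk k]. *)
pose f w := \sum_(k <- J) Num.max (mk k) 0 * `|X k (mk k) w| `^ q.
have mx0 k : 0 <= Num.max (mk k) 0 by rewrite le_max lexx orbT.
have Ff : fails_le P (K * 2 `^ q * (h / e) `^ q) (fun w => f w < h * u `^ q).
  apply: fails_le_markov.
  - by apply: measurable_sum => k; apply: measurable_funM => //.
  - by move=> w; apply: sumr_ge0 => k _; rewrite mulr_ge0// powR_ge0.
  - by rewrite mulr_gt0// powR_gt0.
  - have E : u * (2 * (h / e)) = 1 by rewrite /u; field; rewrite !gt_eqF.
    have Eq : u `^ q * (2 `^ q * (h / e) `^ q) = 1.
      rewrite -powRM ?divr_ge0 ?(ltW h0) ?(ltW e0)// -powRM ?E ?powR1 ?(ltW u0)//.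
      by rewrite mulr_ge0// divr_ge0 ?(ltW h0) ?(ltW e0).
    have -> : h * u `^ q * (K * 2 `^ q * (h / e) `^ q) = h * K.
      transitivity (h * K * (u `^ q * (2 `^ q * (h / e) `^ q))); first by ring.
      by rewrite Eq mulr1.
    under eq_integral do rewrite /f -sumEFin.
    rewrite ge0_integral_sum//; last 2 first.
    - by move=> k; apply/measurable_EFinP; apply: measurable_funM.
    - by move=> k w _; rewrite lee_fin mulr_ge0// powR_ge0.
    apply: (@le_trans _ _ (\sum_(k <- J) (mk k * K)%:E)%E).
      rewrite big_seq [leRHS]big_seq lee_sum// => k kJ.
      under eq_integral do rewrite EFinM.
      rewrite ge0_integralZl_EFin//; last exact/measurable_EFinP.
      rewrite (max_idPl (mJ _ kJ)) EFinM lee_wpmul2l ?lee_fin ?mJ//.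
      by apply: XK; [exact: Jpos|apply/mk0/Jpos].
    by rewrite sumEFin -mulr_suml lee_fin ler_wpM2r.
apply: fails_le_mono Ff => // w fw.
have pw x : 0 <= x -> x <= u + u * (u `^ q)^-1 * x `^ q.
  move=> x0; have [xu|ux] := leP x u.
    by rewrite (le_trans xu)// lerDl mulr_ge0 ?powR_ge0// mulr_ge0 ?invr_ge0 ?powR_ge0// ltW.
  rewrite -[leLHS]add0r; apply: lerD; first exact: ltW.
  have uq : 0 < u `^ q by rewrite powR_gt0.
  rewrite mulrAC ler_pdivlMr// -(mulr_powRB1 (ltW u0) q0) -(mulr_powRB1 x0 q0).
  rewrite mulrCA ler_wpM2l// ?(ltW u0)// ler_wpM2l//.
  by rewrite ge0_ler_powR ?nnegrE ?subr_ge0 ?(ltW u0) ?(ltW q1)// ltW.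
apply: (@le_lt_trans _ _ (\sum_(k <- J) mk k * (u + u * (u `^ q)^-1 * `|X k (mk k) w| `^ q))).
  by rewrite big_seq [leRHS]big_seq ler_sum// => k kJ; rewrite ler_wpM2l ?mJ ?pw.
rewrite (_ : \sum_(k <- J) _ = (\sum_(k <- J) mk k) * u + u * (u `^ q)^-1 * f w); last first.
  rewrite mulr_suml mulr_sumr -big_split/= big_seq [RHS]big_seq; apply: eq_bigr => k kJ.
  by rewrite (max_idPl (mJ _ kJ)); ring.
(* By the choice of [u], both summands are e/2. *)
have -> : e = h * u + u * (u `^ q)^-1 * (h * u `^ q).
  have -> : u * (u `^ q)^-1 * (h * u `^ q) = u * h.
    by field; rewrite gt_eqF// powR_gt0.
  by rewrite /u; field; rewrite gt_eqF.
apply: ler_ltD; first by rewrite ler_wpM2r// ltW.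
by rewrite ltr_pM2l// mulr_gt0// invr_gt0 powR_gt0.
Qed.

(** The weighted-sum bound is used twice at time a, for completed blocks and for the running one.
    All that happens during the window costs a power of its relative length: C2 for the block
    running at a, C3 for the one running at b, C3 for all complete blocks between, and K 2^q for the
    sum over these. *)
Lemma fails_le_window (C1 C2 C3 K c q eps a b : R) :
  0 < eps -> 1 < q -> 0 <= K -> 0 <= C3 -> 1 <= a < b ->
  (forall k m, (0 < k)%N -> 0 < m -> (\int[P]_w (`|X k m w| `^ q)%:E <= K%:E)%E) ->
  (forall (t : R) (J : seq nat) (mu : nat -> R), 1 <= t -> uniq J ->
      (forall k, k \in J -> (0 < k)%N) -> (forall k, k \in J -> 0 < mu k) ->
      \sum_(k <- J) mu k <= t ->
      fails_le P (C1 * t `^ (- c))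
        (fun w => `|\sum_(k <- J) mu k * X k (mu k) w| < eps * t)) ->
  (forall k r m u, (0 < k)%N -> 0 < r -> 0 < m -> 0 < u ->
      fails_le P (C2 * (m / u) `^ q) (fun w => ~ oscillation X k r m u w)) ->
  (forall k m u, (0 < k)%N -> 0 < m -> 0 < u ->
      fails_le P (C3 * (m / u) `^ q)
        (fun w => forall s, 0 < s <= m -> `|s * X k s w| < u + u)) ->
  fails_le P (2 * C1 * a `^ (- c) + (C2 + 2 * C3 + K * 2 `^ q) * ((b - a) / (eps * a)) `^ q)
    (fun w => forall t, a <= t <= b -> `|St (fun k m => X k m : T -> R) mk t w| < 6 * eps).
Proof.
move=> eps0 q1 K0 C30 /andP[a1 ab] XK LLN osc near0.
have a0 : 0 < a := lt_le_trans ltr01 a1.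
have h0 : 0 < b - a by rewrite subr_gt0.
have e0 : 0 < eps * a by rewrite mulr_gt0.
have b0 : 0 < b := lt_trans a0 ab.
set e := eps * a in e0 *; set h := b - a in h0 *.
have k0pos : (0 < ell mk a)%N by exact: ell_gt0.
have k1pos : (0 < ell mk b)%N by exact: ell_gt0.
have r0 : 0 < tbar mk a by exact: tbar_gt0.
have FA := LLN a (index_iota 1 (ell mk a)) mk a1 (iota_uniq _ _).
have {}FA : fails_le P (C1 * a `^ (- c))
    (fun w => `|\sum_(1 <= k < ell mk a) mk k * X k (mk k) w| < e).
  apply: FA.
  - by move=> k; rewrite mem_index_iota => /andP[].
  - by move=> k; rewrite mem_index_iota => /andP[k0 _]; exact: mk0.
  - have := @Msum_lt a (ell mk a).-1; rewrite prednK// leqnn => /(_ isT) /ltW.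
    by rewrite /Msum prednK.
have FC : fails_le P (C1 * a `^ (- c))
    (fun w => `|tbar mk a * X (ell mk a) (tbar mk a) w| < e).
  have := LLN a [:: ell mk a] (fun=> tbar mk a) a1 isT.
  rewrite big_seq1 => H; apply: fails_le_mono (H _ _ _) => //.
  - by move=> w; rewrite big_seq1.
  - by move=> k; rewrite inE => /eqP ->.
  - rewrite /tbar gerBl -Msum0; exact: Msum_le.
have FD0 := osc _ _ _ _ k0pos r0 h0 e0.
have FD1 := near0 _ _ _ k1pos h0 e0.
pose J := index_iota (ell mk a).+1 (ell mk b).
have Jh : \sum_(k <- J) mk k <= h by apply: sum_between_le; exact: ltW.
have Jpos k : k \in J -> (0 < k)%N.
  by rewrite mem_index_iota => /andP[ak _]; exact: leq_ltn_trans ak.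
have mJh k : k \in J -> mk k <= h.
  move=> kJ; apply: le_trans Jh; rewrite (big_rem _ kJ)/= lerDl big_seq sumr_ge0// => j jJ.
  by apply/ltW/mk0/Jpos; exact: mem_rem jJ.
have FDk : fails_le P (C3 * (h / e) `^ q) (fun w => forall k, k \in J ->
    forall s, 0 < s <= mk k -> `|s * X k s w| < e + e).
  have := @fails_le_seq _ _ _ P _ J (fun k => C3 * (mk k / e) `^ q) _
    (fun k kJ => near0 k (mk k) e (Jpos k kJ) (mk0 (Jpos k kJ)) e0).
  apply: fails_le_mono => //.
  rewrite -mulr_sumr ler_wpM2l//.
  (* The union over blocks is paid by mass: m_k <= h and q >= 1 give (m_k/h)^q <= m_k/h, and these
     ratios sum to at most 1. *)
  apply: (@le_trans _ _ (\sum_(k <- J) mk k / h * (h / e) `^ q)).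
    rewrite big_seq [leRHS]big_seq ler_sum// => k kJ.
    have -> : mk k / e = mk k / h * (h / e) by field; rewrite !gt_eqF.
    apply: ge1r_powRZ; rewrite ?divr_ge0 ?(ltW h0) ?(ltW e0) ?(ltW q1)//.
    by rewrite divr_gt0 ?mk0 ?Jpos//= ler_pdivrMr// mul1r mJh.
  rewrite -!mulr_suml -[leRHS]mul1r ler_wpM2r ?powR_ge0//.
  by rewrite ler_pdivrMr// mul1r.
have FB := fails_le_increment q1 K0 e0 h0 Jpos XK Jh.
have := fails_le_and FA (fails_le_and FC (fails_le_and FD0 (fails_le_and FD1 (fails_le_and FDk FB)))).
apply: fails_le_mono.
  by rewrite le_eqVlt; apply/orP; left; apply/eqP; ring.
move=> w [HA [HC [HD0 [HD1 [HDk HB]]]]] t /andP[at_ tb].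
have t0 : 0 < t := lt_le_trans a0 at_.
have := @Zt_window (fun k s => X k s w) a b e _ HA HC _ HD1 _ HB t.
rewrite a0 (ltW ab) at_ tb St_Zt => /(_ isT) H.
rewrite normrM normfV (gtr0_norm t0) ltr_pdivrMr//.
apply: (@lt_le_trans _ _ (6 * e)); last by rewrite -mulrA ler_pM2l// /e ler_pM2l.
apply: H => //.
- by move=> s sh; exact: not_oscillation HD0 sh.
- by move=> k kk; apply: HDk; rewrite mem_index_iota.
Qed.

End clock.

(** * The grid and almost sure convergence *)

Section grid.
Context {R : realType}.

(** Convexity: the right side is the chord over [0, 1]. The induction leaves the surplus (2^p - 1)
    (x - x^2). *)
Lemma exp1D_le (x : R) (p : nat) : 0 <= x <= 1 -> (1 + x) ^+ p <= 1 + (2 ^+ p - 1) * x.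
Proof.
move=> /andP[x0 x1]; elim: p => [|p IH]; first by rewrite !expr0 subrr mul0r addr0.
rewrite exprS; apply: (@le_trans _ _ ((1 + x) * (1 + (2 ^+ p - 1) * x))).
  by rewrite ler_wpM2l// addr_ge0.
have p1 : 0 <= 2 ^+ p - 1 :> R by rewrite subr_ge0 exprn_ege1// ler1n.
have xx : x * x <= x by rewrite -[leRHS]mulr1 ler_wpM2l.
rewrite -subr_ge0 exprS.
have -> : 1 + (2 * 2 ^+ p - 1) * x - (1 + x) * (1 + (2 ^+ p - 1) * x) =
  (2 ^+ p - 1) * (x - x * x) by ring.
by rewrite mulr_ge0// subr_ge0.
Qed.

Definition grid (p i : nat) : R := i.+1%:R ^+ p.

Lemma grid_ge1 p i : 1 <= grid p i.
Proof. by rewrite exprn_ege1// ler1n. Qed.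

Lemma grid_lt p i : (0 < p)%N -> grid p i < grid p i.+1.
Proof. by move=> p0; rewrite ltrXn2r// -?lt0n// ltr_nat. Qed.

Lemma grid_ge p i : (0 < p)%N -> i.+1%:R <= grid p i.
Proof.
case: p => // p _; rewrite /grid exprS -[leLHS]mulr1 ler_wpM2l//.
by rewrite exprn_ege1// ler1n.
Qed.

(** The ratio is (1 + 1/(i+1))^p - 1, of order 1/(i+1) whatever p is; so p may be as large as the
    bound at grid times demands. *)
Lemma grid_increment p i : (grid p i.+1 - grid p i) / grid p i <= 2 ^+ p / i.+1%:R.
Proof.
have i0 : 0 < i.+1%:R :> R by rewrite ltr0n.
have g0 : 0 < grid p i := lt_le_trans ltr01 (grid_ge1 p i).
rewrite mulrBl divff ?gt_eqF// lerBlDl.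
have -> : grid p i.+1 / grid p i = (1 + i.+1%:R^-1) ^+ p.
  rewrite /grid -expr_div_n; congr (_ ^+ p).
  by rewrite -(natr1 i.+1) mulrDl divff ?gt_eqF// mul1r.
apply: le_trans (exp1D_le _ _) _.
  by rewrite invr_ge0 ltW//= invf_le1// ler1n.
by rewrite lerD2l ler_wpM2r ?invr_ge0 ?(ltW i0)// gerBl.
Qed.

Lemma grid_bracket p N (t : R) : (0 < p)%N -> grid p N <= t ->
  exists2 i, (N <= i)%N & grid p i <= t <= grid p i.+1.
Proof.
move=> p0 Nt; have ex : exists i, (N <= i)%N && (t <= grid p i.+1).
  exists (maxn N (Num.truncn t)); rewrite leq_maxl/=.
  apply: le_trans (grid_ge _ p0); apply: (le_trans (ltW (truncnS_gt t))).
  by rewrite ler_nat ltnS ltnW// ltnS leq_maxr.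
have [i /andP[Ni ti] imin] := ex_minnP ex.
exists i => //; rewrite ti andbT.
move: Ni; rewrite leq_eqVlt => /predU1P[<-//|].
case: i ti imin => // j tj jmin Nj.
rewrite leNgt; apply/negP => tj'.
have := jmin j; rewrite -ltnS Nj (ltW tj') => /(_ isT).
by rewrite ltnn.
Qed.

(* Cauchy condensation *)
Lemma sum_powRN_le (q : R) n : 1 < q ->
  \sum_(0 <= i < n) (i.+1%:R : R) `^ (- q) <= (1 - 2 `^ (1 - q))^-1.
Proof.
move=> q1; have q0 : 0 < q := lt_trans ltr01 q1.
have x1 : 0 <= 2 `^ (1 - q) < (1 : R).
  by rewrite powR_ge0 powR2_lt1// subr_lt0.
(* Because of the shift in [i.+1], stopping at 2^N - 1 means summing over the integers from 1 to 2^N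
   - 1, that is, over N complete dyadic blocks. *)
have dyadic N : \sum_(0 <= i < (2 ^ N).-1) (i.+1%:R : R) `^ (- q) <=
    \sum_(0 <= j < N) (2 `^ (1 - q)) ^+ j.
  elim: N => [|N IH]; first by rewrite !big_geq.
  have le2 : ((2 ^ N).-1 <= (2 ^ N.+1).-1)%N.
    by rewrite -!subn1 leq_sub2r// leq_exp2l.
  rewrite (@big_cat_nat _ _ _ (2 ^ N).-1)//= [leRHS]big_nat_recr//= lerD//.
  apply: (@le_trans _ _ (\sum_((2 ^ N).-1 <= i < (2 ^ N.+1).-1) ((2 ^ N)%:R : R) `^ (- q))).
    rewrite big_nat [leRHS]big_nat ler_sum// => i /andP[Ni _].
    rewrite !powRN lef_pV2 ?posrE ?powR_gt0 ?ltr0n ?expn_gt0//.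
    rewrite ge0_ler_powR ?nnegrE ?(ltW q0)// ler_nat.
    by rewrite -(@prednK (2 ^ N)) ?expn_gt0.
  rewrite big_const_nat iter_addr_0.
  have -> : ((2 ^ N.+1).-1 - (2 ^ N).-1 = 2 ^ N)%N.
    have : (0 < 2 ^ N)%N by rewrite expn_gt0.
    by rewrite expnS mul2n -addnn; case: (2 ^ N)%N => // a _; rewrite addSn /= addKn.
  rewrite -[leLHS]mulr_natl natrX -(powR_mulrn N (ler0n R 2)) -powRrM.
  rewrite -(powR_mulrn N (powR_ge0 2 (1 - q))) -powRrM.
  rewrite -powRD ?pnatr_eq0 ?implybT//.
  by rewrite le_eqVlt; apply/orP; left; apply/eqP; congr (_ `^ _); ring.
have nn : (n <= (2 ^ n).-1)%N by rewrite -ltnS prednK ?expn_gt0// ltn_expl.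
apply: (@le_trans _ _ (\sum_(0 <= i < (2 ^ n).-1) (i.+1%:R : R) `^ (- q))).
  by rewrite [leRHS](@big_cat_nat _ _ _ n)//= lerDl sumr_ge0// => i _; exact: powR_ge0.
by apply: (le_trans (dyadic n)); exact: sum_geometric_le.
Qed.

End grid.

(** * From the hypotheses to the estimates, and the limit *)

Section reduction.
Context {d : measure_display} {T : measurableType d} {R : realType}.
Context (P : probability T R).

Lemma indep_in_k_pair (X : nat -> R -> T -> R) (j k : nat) (m n : R) :
  indep_in_k P X -> (0 < j)%N -> (0 < k)%N -> j != k -> 0 < m -> 0 < n ->
  indep_pair P (X j m) (X k n).
Proof.
move=> ind j0 k0 jk m0 n0 B1 B2 mB1 mB2.
pose A i := if i == j then X j m @^-1` B1 else X k n @^-1` B2.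
have := ind [:: j; k] A; rewrite /= inE jk j0 k0 /= => /(_ isT isT).
have Aj : A j = X j m @^-1` B1 by rewrite /A eqxx.
have Ak : A k = X k n @^-1` B2 by rewrite /A eq_sym (negbTE jk).
rewrite !big_cons big_nil mule1 Aj Ak => <-.
  congr (P _); apply/seteqP; split => w.
    move=> [w1 w2] i /=; rewrite !inE => /orP[/eqP ->|/eqP ->]; first by rewrite Aj.
    by rewrite Ak.
  move=> H; split; first by rewrite -Aj; apply: H; rewrite /= inE eqxx.
  by rewrite -Ak; apply: H; rewrite /= !inE eqxx orbT.
move=> i; rewrite !inE => /orP[/eqP ->|/eqP ->].
  by rewrite Aj; apply: sub_sigma_algebra; exists m, B1.
by rewrite Ak; apply: sub_sigma_algebra; exists n, B2.
Qed.

(** Domination compares strict tails while the moment lemmas take closed ones; passing from u <= V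
    to u/2 < V costs the factor 2^b. *)
Lemma dominated_tail (d' : measure_display) (T' : measurableType d')
    (Q : probability T' R) (Xs : {RV Q >-> R}) (V : {RV P >-> R}) (b K u : R) :
  0 < b -> (\int[Q]_w (`|Xs w| `^ b)%:E <= K%:E)%E ->
  (forall x : R, (P [set w | (x < V w)%R] <= Q [set w | (x < Xs w)%R])%E) ->
  0 < u -> (P [set w | (u <= V w)%R] <= (K * 2 `^ b * u `^ (- b))%:E)%E.
Proof.
move=> b0 QK VXs u0; have u2 : 0 < u / 2 by rewrite divr_gt0.
have mgt (d1 : measure_display) (T1 : measurableType d1) (f : T1 -> R) (x : R) :
    measurable_fun setT f -> measurable [set w | (x < f w)%R].
  move=> mf; rewrite (_ : mkset _ = f @^-1` `]x, +oo[); last first.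
    by apply/seteqP; split => w /=; rewrite in_itv/= andbT.
  by rewrite -[X in measurable X]setTI; exact: mf.
have mV : measurable_fun setT V by exact: measurable_funPT.
have mXs : measurable_fun setT Xs by exact: measurable_funPT.
have [F [mF QF FX]] := fails_le_moment mXs b0 ltr01 u2 QK.
apply: (@le_trans _ _ (P [set w | (u / 2 < V w)%R])).
  apply: le_measure; rewrite ?inE; [exact: measurable_superlevel|exact: mgt|].
  by move=> w /=; apply: lt_le_trans; rewrite ltr_pdivrMr// ltr_pMr// ltr1n.
apply: (le_trans (VXs _)); apply: (@le_trans _ _ (Q F)).
  apply: le_measure; rewrite ?inE//; first exact: mgt.
  move=> w /= uX; apply: contrapT => /FX; rewrite mul1r => /(le_lt_trans (ler_norm _)).
  by rewrite ltNge (ltW uX).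
apply: (le_trans QF); rewrite lee_fin.
have -> : 1 / (u / 2) = 2 * u^-1 by field; rewrite gt_eqF.
rewrite powRM ?invr_ge0 ?(ltW u0)// -mulrA powRN.
by rewrite -(powR_inv1 (ltW u0)) -powRrM mulN1r powRN.
Qed.

Lemma St_cvg0 (X : nat -> R -> {RV P >-> R}) (mk : nat -> R) (C2 C3 K c q : R) :
  1 < q -> 0 <= K -> 0 <= C2 -> 0 <= C3 -> 0 < c ->
  (forall k, (0 < k)%N -> 0 < mk k) ->
  Msum mk n @[n --> \oo] --> +oo ->
  (forall k m, (0 < k)%N -> 0 < m -> (\int[P]_w (`|X k m w| `^ q)%:E <= K%:E)%E) ->
  (forall eps, 0 < eps -> exists2 C1 : R, 0 <= C1 &
    forall (t : R) (J : seq nat) (mu : nat -> R), 1 <= t -> uniq J ->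
      (forall k, k \in J -> (0 < k)%N) -> (forall k, k \in J -> 0 < mu k) ->
      \sum_(k <- J) mu k <= t ->
      fails_le P (C1 * t `^ (- c))
        (fun w => `|\sum_(k <- J) mu k * X k (mu k) w| < eps * t)) ->
  (forall k r m u, (0 < k)%N -> 0 < r -> 0 < m -> 0 < u ->
      fails_le P (C2 * (m / u) `^ q) (fun w => ~ oscillation X k r m u w)) ->
  (forall k m u, (0 < k)%N -> 0 < m -> 0 < u ->
      fails_le P (C3 * (m / u) `^ q)
        (fun w => forall s, 0 < s <= m -> `|s * X k s w| < u + u)) ->
  {ae P, forall w, St (fun k m => X k m : T -> R) mk t w @[t --> +oo] --> 0}.
Proof.
move=> q1 K0 C20 C30 c0 mk0 mkoo XK LLN osc near0.
have q0 : 0 < q := lt_trans ltr01 q1.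
pose p := (Num.truncn (q / c)).+1.
have pc : q <= p%:R * c by rewrite -ler_pdivrMr// ltW// truncnS_gt.
pose S := (fun k m => X k m : T -> R).
(* The levels 1/(n+1) keep the almost sure statements countable, so that a single null set serves
   them all. *)
have ev n : {ae P, forall w, \forall i \near \oo,
    forall t, @grid R p i <= t <= @grid R p i.+1 -> `|St S mk t w| < 6 * n.+1%:R^-1}.
  have eps0 : 0 < n.+1%:R^-1 :> R by rewrite invr_gt0 ltr0n.
  have [C1 C10 H1] := LLN _ eps0.
  pose D := C2 + 2 * C3 + K * 2 `^ q.
  have D0 : 0 <= D by rewrite /D !addr_ge0// mulr_ge0// powR_ge0.
  (* At a = (i+1)^p, p c >= q gives a^(-c) <= (i+1)^(-q), while the relative length of the window
     divided by eps is at most 2^p (n+1) / (i+1). *)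
  pose D' := 2 * C1 + D * (2 ^+ p * n.+1%:R) `^ q.
  have D'0 : 0 <= D' by rewrite /D' addr_ge0 ?mulr_ge0 ?powR_ge0.
  apply: (@fails_le_borel_cantelli _ _ _ P (fun i => D' * i.+1%:R `^ (- q))
    (D' * (1 - 2 `^ (1 - q))^-1)); last first.
    by move=> N; rewrite -mulr_sumr ler_wpM2l// sum_powRN_le.
  move=> i; have g1 := @grid_ge1 R p i; have g0 := lt_le_trans ltr01 g1.
  have gg : 1 <= @grid R p i < @grid R p i.+1.
    by apply/andP; split; [exact: g1|exact: grid_lt].
  have := fails_le_window mk0 mkoo eps0 q1 K0 C30 gg XK H1 osc near0.
  apply: fails_le_mono => //.
  rewrite -/D /D' [leRHS]mulrDl lerD//.
    rewrite ler_wpM2l ?mulr_ge0// /grid -powR_mulrn// -powRrM mulrN.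
    by rewrite ler_powR ?ler1n// lerN2.
  rewrite -mulrA ler_wpM2l//.
  have -> : (i.+1%:R : R) `^ (- q) = (i.+1%:R^-1) `^ q.
    by rewrite -(powR_inv1 (ler0n _ _)) -powRrM mulN1r.
  rewrite -powRM ?mulr_ge0 ?exprn_ge0 ?invr_ge0//.
  have dg : 0 <= @grid R p i.+1 - @grid R p i :> R by rewrite subr_ge0 ltW// grid_lt.
  have -> : (@grid R p i.+1 - @grid R p i) / (n.+1%:R^-1 * @grid R p i) =
      n.+1%:R * ((@grid R p i.+1 - @grid R p i) / @grid R p i) :> R.
    by field; rewrite gt_eqF//= addrC natr1 pnatr_eq0.
  rewrite ge0_ler_powR ?nnegrE ?(ltW q0) ?mulr_ge0 ?exprn_ge0 ?invr_ge0 ?(ltW g0)//.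
  rewrite [leRHS](_ : _ = n.+1%:R * (2 ^+ p / i.+1%:R)); last by ring.
  by rewrite ler_wpM2l// grid_increment.
have := ae_foralln ev; apply: filterS => w Hw.
apply/cvgr0Pnorm_lt => e e0.
pose n := Num.truncn (6 / e).
have ne : 6 * n.+1%:R^-1 < e.
  by rewrite ltr_pdivrMr ?ltr0n// mulrC -ltr_pdivrMr// truncnS_gt.
have [N _ HN] := Hw n.
exists (@grid R p N); split; first exact: num_real.
move=> t Nt; have [i Ni ti] := @grid_bracket R p N t isT (ltW Nt).
by apply: lt_trans ne; exact: (HN i Ni t ti).
Qed.

End reduction.

Theorem theorem2p3 (d : measure_display) (T : measurableType d) (R : realType)
  (P : probability T R) (X : nat -> R -> {RV P >-> R}) (mk : nat -> R) :
  (* integrability *)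
  (forall k m, (0 < k)%N -> 0 < m -> P.-integrable setT (EFin \o X k m)) ->
  (* independence in k *)
  indep_in_k P (fun k m => X k m : T -> R) ->
  (* (C) *)
  (forall k m, (0 < k)%N -> 0 < m -> ('E_P[X k m] = 0)%E) ->
  (* (S1) *)
  (exists2 delta : R, 0 < delta &
     forall eps : R, 0 < eps -> exists C : R, forall m : R, 0 < m ->
       (ereal_sup [set P [set w | (eps < `|X k m w|)%R] | k in [set k : nat | (0 < k)%N]]
          < (C / m `^ delta)%R%:E)%E) ->
  (* (S2) *)
  (exists (d' : measure_display) (T' : measurableType d') (Q : probability T' R)
          (Xs : {RV Q >-> R}) (gamma : R),
     0 < gamma /\
     (\int[Q]_w (`|Xs w| `^ (2 + gamma))%R%:E < +oo)%E /\
     forall x : R,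
       (ereal_sup [set P [set w | (x < X p.1 p.2 w)%R] | p in [set p : nat * R | (0 < p.1)%N /\ (0 < p.2)%R]]
          <= Q [set w | (x < Xs w)%R])%E) ->
  (* (S3) *)
  (forall eps : R, 0 < eps -> exists beta : R, exists2 Ceps : R, 1 < beta /\ 0 < Ceps &
     forall t r m : R, 0 < t -> 0 < r -> 0 < m ->
       let E k := [set w | ((t * eps)%R%:E <=
                    ereal_sup [set (`|(r + s) * X k (r + s) w - r * X k r w|)%R%:E
                               | s in `[0%R, m]%classic])%E] in
       (forall k, (0 < k)%N -> measurable (E k)) /\
       (ereal_sup [set P (E k) | k in [set k : nat | (0 < k)%N]] <= (Ceps * m `^ beta / t `^ beta)%R%:E)%E) ->
  (* the sequence m_k *)
  (forall k, (0 < k)%N -> 0 < mk k) ->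
  Msum mk n @[n --> \oo] --> +oo ->
  {ae P, forall w, St (fun k m => X k m : T -> R) mk t w @[t --> +oo] --> 0}.
Proof.
move=> iX ind X0 [delta d0 S1] [d' [T' [Q [Xs [gamma [g0 [Qg S2]]]]]]] S3 mk0 mkoo.
(* At eps = 1 the threshold t eps is t, which ranges over all positive levels; a single exponent
   beta then serves throughout. *)
have [beta [Ce [b1 Ce0] {}S3]] := S3 1 ltr01.
have osc k r m t : (0 < k)%N -> 0 < t -> 0 < r -> 0 < m ->
    measurable (oscillation X k r m t) /\
    (P (oscillation X k r m t) <= (Ce * m `^ beta / t `^ beta)%:E)%E.
  move=> k0 t0 r0 m0; have := S3 t r m t0 r0 m0; rewrite mulr1 => -[mE PE].
  by split; [exact: mE|exact: (ereal_sup_image_le PE k0)].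
have X0' k m : (0 < k)%N -> 0 < m -> \int[P]_w X k m w = 0.
  by move=> k0 m0; have := X0 k m k0 m0; rewrite expectation_def /Rintegral => ->.
pose K0 := fine (\int[Q]_w (`|Xs w| `^ (2 + gamma))%:E).
have K0E : (\int[Q]_w (`|Xs w| `^ (2 + gamma))%:E = K0%:E)%E.
  rewrite fineK// ge0_fin_numE//; apply: integral_ge0 => w _.
  by rewrite lee_fin powR_ge0.
have K00 : 0 <= K0.
  by rewrite -lee_fin -K0E; apply: integral_ge0 => w _; rewrite lee_fin powR_ge0.
pose b := 2 + gamma.
have bgt0 : 0 < b by rewrite addr_gt0.
have bgt1 : 1 < b by rewrite /b; lra.
have tail k m u : (0 < k)%N -> 0 < m -> 1 <= u ->
    (P [set w | (u <= X k m w)%R] <= (K0 * 2 `^ b * u `^ (- b))%:E)%E.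
  move=> k0 m0 u1; have u0 := lt_le_trans ltr01 u1.
  apply: (dominated_tail (Xs := Xs) (K := K0) bgt0 _ _ u0); first by rewrite /b K0E.
  by move=> x; exact: (ereal_sup_image_le (i := (k, m)) (S2 x)).
pose K1 := 2 * (1 + K0 * 2 `^ b * 2 `^ 1 * (1 - 2 `^ (1 - b))^-1).
have XK1 k m : (0 < k)%N -> 0 < m -> (\int[P]_w (`|X k m w|)%:E <= K1%:E)%E.
  move=> k0 m0; apply: first_moment_le => //.
  - by rewrite mulr_ge0// powR_ge0.
  - exact: iX.
  - exact: X0'.
  - by move=> u; exact: tail.
(* The midpoint of 1 and min(beta, 2) lies strictly above 1, strictly below beta, and at most at
   2. *)
pose q := (1 + Num.min beta 2) / 2.
have b2 : 1 < Num.min beta 2 by rewrite lt_min b1 ltr1n.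
have mb : Num.min beta 2 <= beta by rewrite ge_min lexx.
have m2 : Num.min beta 2 <= 2 by rewrite ge_min lexx orbT.
have q1 : 1 < q by rewrite /q; lra.
have q2 : q <= 2 by rewrite /q; lra.
have qb : q < beta by rewrite /q; lra.
have q0 : 0 < q by lra.
pose Kq := 1 + Ce * 2 `^ beta * 2 `^ q * (1 - 2 `^ (q - beta))^-1.
have XKq k m : (0 < k)%N -> 0 < m -> (\int[P]_w (`|X k m w| `^ q)%:E <= Kq%:E)%E.
  move=> k0 m0; apply: expectation_powR_le => //.
  - by rewrite q0.
  - by rewrite mulr_ge0 ?powR_ge0// ltW.
  - by apply: measurableT_comp => //; exact: measurable_funPT.
  - move=> u u1; apply: (weak_tail (K := K1) (m := m) _ b1) => //.
    + exact: ltW.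
    + by move=> m' m'0; exact: XK1.
    + by move=> t r m' t0 r0 m'0; exact: osc.
    + exact: lt_le_trans u1.
have Kq0 : 0 <= Kq.
  rewrite -lee_fin; apply: le_trans (XKq 1%N 1 _ _) => //.
  by apply: integral_ge0 => w _; rewrite lee_fin powR_ge0.
pose C2 := Num.max Ce 1.
have C20 : 0 <= C2 by rewrite le_max ler01 orbT.
have osc' k r m u : (0 < k)%N -> 0 < r -> 0 < m -> 0 < u ->
    fails_le P (C2 * (m / u) `^ q) (fun w => ~ oscillation X k r m u w).
  move=> k0 r0 m0 u0; have [mo Po] := osc k r m u k0 u0 r0 m0.
  exists (oscillation X k r m u); split => //.
  by apply: (oscillation_exponent _ m0 u0 mo Po); rewrite q0 ltW.
have near0 k m u : (0 < k)%N -> 0 < m -> 0 < u ->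
    fails_le P ((C2 + Kq) * (m / u) `^ q)
      (fun w => forall s, 0 < s <= m -> `|s * X k s w| < u + u).
  move=> k0 m0 u0; apply: fails_le_near0 => //.
    by move=> m' m'0; exact: XKq.
  by move=> r m' r0 m'0; exact: osc'.
have q12 : 1 < q <= 2 by rewrite q1.
have S1' eps : 0 < eps -> exists2 C : R, 0 <= C & forall k m, (0 < k)%N -> 0 < m ->
    (P [set w | (eps < `|X k m w|)%R] <= (C / m `^ delta)%:E)%E.
  move=> e0; have [C HC] := S1 _ e0; exists C.
    have := ereal_sup_image_le (i := 1%N) (ltW (HC 1 ltr01)) isT.
    rewrite powR1 divr1 => H; rewrite -lee_fin; apply: le_trans H.
    exact: measure_ge0.
  by move=> k m k0 m0; exact: (ereal_sup_image_le (ltW (HC m m0)) k0).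
have ind' j k m n : (0 < j)%N -> (0 < k)%N -> j != k -> 0 < m -> 0 < n ->
    indep_pair P (X j m) (X k n).
  by move=> j0 k0 jk m0 n0; exact: (indep_in_k_pair ind).
have [c c0 LLN] := fails_le_weighted_sum q12 Kq0 d0 iX X0' XKq ind' S1'.
exact: (St_cvg0 q1 Kq0 C20 (addr_ge0 C20 Kq0) c0 mk0 mkoo XKq LLN osc' near0).
Qed.
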